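(* Let $\mathcal T$ be a right tensor $C^*$-precategory. There is a natural isomorphism $\mathcal{DR}(\mathcal T)\cong\mathcal O_{\mathcal T}(\mathcal T,\mathcal T)$; thus every algebra $\mathcal{DR}(\mathcal T)$ is an algebra of the type $\mathcal O_{\mathcal T}(\mathcal K,\mathcal J)$. Conversely, for all ideals $\mathcal K,\mathcal J$ in $\mathcal T$ such that $\mathcal J\subset J(\mathcal K)$, the mappings $$\mathcal K(n,m)\ni a\longmapsto\iota^{\mathcal M}_{n,m}(a)\in\mathcal K_{\mathcal J}(n,m),\qquad n,m\in\mathbb N,$$ induce an isomorphism $\mathcal O_{\mathcal T}(\mathcal K,\mathcal J)\cong\mathcal{DR}(\mathcal K_{\mathcal J})$.
   Context: $\mathbb N=\{0,1,2,\dots\}$. A $C^*$-precategory $\mathcal T$ with object set $\mathbb N$ consists of complex Banach spaces $\mathcal T(n,m)$, bilinear associative compositions $\mathcal T(n,m)\times\mathcal T(m,l)\to\mathcal T(n,l)$ with $\|ab\|\le\|a\|\|b\|$, and antilinear involutive maps $*:\mathcal T(n,m)\to\mathcal T(m,n)$ with $(ab)^*=b^*a^*$ and $\|a^*a\|=\|a\|^2$. An ideal $\mathcal K$ in $\mathcal T$ is a family of closed subspaces $\mathcal K(n,m)\subset\mathcal T(n,m)$ with $\mathcal T(n,m)\mathcal K(m,l)\subset\mathcal K(n,l)$, $\mathcal K(n,m)\mathcal T(m,l)\subset\mathcal K(n,l)$; inclusions are entrywise; $q_{\mathcal J}:\mathcal T\to\mathcal T/\mathcal J$ is the entrywise quotient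 map. A right tensor $C^*$-precategory is such a $\mathcal T$ with linear maps $\otimes1:\mathcal T(n,m)\to\mathcal T(n+1,m+1)$ preserving composition and involution; $\otimes1^k$ is the $k$-th iterate. $J(\mathcal K)(n,m)=\{a\in\mathcal K(n,m):a\otimes1\in\mathcal K(n+1,m+1)\}$. $\mathcal{DR}(\mathcal T)$: for $k\in\mathbb Z$ let $\mathcal{DR}^{(k)}(\mathcal T)=\varinjlim_r\mathcal T(r+k,r)$ be the Banach space inductive limit along the maps $\otimes1:\mathcal T(r+k,r)\to\mathcal T(r+1+k,r+1)$. $\bigoplus_k\mathcal{DR}^{(k)}(\mathcal T)$ (algebraic sum) is a $\mathbb Z$-graded $*$-algebra with operations induced by composition and involution, and $\mathcal{DR}(\mathcal T)$ is its completion in the unique $C^*$-norm for which the automorphic circle action defined by the grading (multiplication by $z^k$ in degree $k$) is isometric. A right tensor representation of $\mathcal K$ in a $C^*$-algebra $B$ is a family of linear maps $\pi_{n,m}:\mathcal K(n,m)\to B$ with $\pi_{n,m}(a)^*=\pi_{m,n}(a^* )$ and $\pi_{n,m}(a)\pi_{m+k,l}(b)=\pi_{n+k,l}((a\otimes1^k)b)$ for $a\in\mathcal K(n,m)$, $b\in\mathcal K(m+k,l)$; it is coisometric on $\mathcal J\subset J(\mathcal K)$ if $\pi_{n,m}(a)=\pi_{n+1,m+1}(a\otimes1)$ for $a\in\mathcal J(n,m)$. $\mathcal O_{\mathcal T}(\mathcal K,\mathcal J)$ is the universal $C^*$-algebra generated by the image of a universal right tensor representation of $\mathcal K$ coisometric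 on $\mathcal J$. $\mathcal K_{\mathcal J}$: let $\mathcal M_{\mathcal T}(\mathcal K)$ be the $*$-algebra of matrices $\{a_{n,m}\}$, $a_{n,m}\in\mathcal K(n,m)$, finitely many nonzero, with entrywise linear structure, $(a^* )_{n,m}=(a_{m,n})^*$ and bilinear product where, with $\iota^{\mathcal M}_{n,m}(a)$ the matrix with single entry $a$ at $(n,m)$, $\iota^{\mathcal M}_{n,m}(a)\star\iota^{\mathcal M}_{p,l}(b)$ is $\iota^{\mathcal M}_{n+p-m,l}((a\otimes1^{p-m})b)$ if $m\le p$ and $\iota^{\mathcal M}_{n,l+m-p}(a(b\otimes1^{m-p}))$ if $p<m$. Let $\mathcal M(r+k,r)$ be the set of matrices with $a_{n,m}\neq0\Rightarrow n-m=k,\ m\le r$, with seminorm $\|a\|^{\mathcal J}_{r+k,r}=\max\{\max_{s<r}\|q_{\mathcal J}(x_s)\|,\|x_r\|\}$, $x_s=\sum_{0\le i\le s,\,i+k\ge0}a_{i+k,i}\otimes1^{s-i}$. Then $\mathcal K_{\mathcal J}(n,m)=\mathcal M(n,m)/\|\cdot\|^{\mathcal J}_{n,m}$ (quotient by zero-seminorm elements) is a right tensor $C^*$-precategory with right tensoring $\otimes_{\mathcal J}1$ induced by the inclusions $\mathcal M(n,m)\subset\mathcal M(n+1,m+1)$. *)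

(* Defs.v *)
From HB Require Import structures.
From mathcomp Require Import all_boot all_order all_algebra.
From mathcomp Require Import complex.
From mathcomp Require Import all_classical all_reals all_analysis.

Set Implicit Arguments.
Unset Strict Implicit.
Unset Printing Implicit Defensive.

Import Order.TTheory GRing.Theory Num.Theory numFieldNormedType.Exports.

Local Open Scope classical_set_scope.
Local Open Scope ring_scope.
Local Open Scope complex_scope.

(* In a normed module over R[i] the norm `|x| is a (nonnegative) element of
   R[i]; [nrm x] is the same number seen in R, where infima and limits of
   norms are taken. *)
Definition nrm (R : realType) (V : normedModType R[i]) (x : V) : R :=
  complex.Re `|x|.

(** * C*-algebras, not assumed to be unital *)

Record cstarAlg (R : realType) := CstarAlg {
  cs_car :> completeNormedModType R[i];
  cs_mul : cs_car -> cs_car -> cs_car;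
  cs_star : cs_car -> cs_car;
  cs_mul_linearl : forall y, linear (fun x => cs_mul x y);
  cs_mul_linearr : forall x, linear (cs_mul x);
  cs_mulA : forall x y z, cs_mul x (cs_mul y z) = cs_mul (cs_mul x y) z;
  cs_star_antilinear : forall (c : R[i]) x y,
    cs_star (c *: x + y) = c^* *: cs_star x + cs_star y;
  cs_starK : forall x, cs_star (cs_star x) = x;
  cs_star_mul : forall x y, cs_star (cs_mul x y) = cs_mul (cs_star y) (cs_star x);
  cs_norm_mul : forall x y, `|cs_mul x y| <= `|x| * `|y|;
  cs_norm_star_mul : forall x, `|cs_mul (cs_star x) x| = `|x| ^+ 2 }.

Record is_star_hom (R : realType) (A B : cstarAlg R) (f : A -> B) : Prop := {
  star_hom_linear : linear f;
  star_hom_mul : forall x y, f (cs_mul x y) = cs_mul (f x) (f y);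
  star_hom_star : forall x, f (cs_star x) = cs_star (f x) }.

Definition is_star_iso (R : realType) (A B : cstarAlg R) (f : A -> B) : Prop :=
  is_star_hom f /\ bijective f.

Record is_cstar_subalg (R : realType) (A : cstarAlg R) (S : set A) : Prop := {
  cstar_sub0 : S 0;
  cstar_subD : forall (c : R[i]) x y, S x -> S y -> S (c *: x + y);
  cstar_subM : forall x y, S x -> S y -> S (cs_mul x y);
  cstar_sub_star : forall x, S x -> S (cs_star x);
  cstar_sub_closed : closed S }.

(** * C*-precategories with object set nat *)

Record cprecat (R : realType) := Cprecat {
  hom :> nat -> nat -> completeNormedModType R[i];
  comp : forall n m l, hom n m -> hom m l -> hom n l;
  star : forall n m, hom n m -> hom m n;
  comp_linearl : forall n m l (b : hom m l), linear (fun a : hom n m => comp a b);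
  comp_linearr : forall n m l (a : hom n m), linear (fun b : hom m l => comp a b);
  compA : forall n m l p (a : hom n m) (b : hom m l) (c : hom l p),
    comp a (comp b c) = comp (comp a b) c;
  norm_comp : forall n m l (a : hom n m) (b : hom m l),
    `|comp a b| <= `|a| * `|b|;
  star_antilinear : forall n m (c : R[i]) (a b : hom n m),
    star (c *: a + b) = c^* *: star a + star b;
  starK : forall n m (a : hom n m), star (star a) = a;
  star_comp : forall n m l (a : hom n m) (b : hom m l),
    star (comp a b) = comp (star b) (star a);
  norm_star_comp : forall n m (a : hom n m), `|comp (star a) a| = `|a| ^+ 2 }.

(* Right tensor C*-precategories; [tens1 a] is a (x) 1. *)
Record rtcat (R : realType) := Rtcat {
  rt_cat :> cprecat R;
  tens1 : forall n m, rt_cat n m -> rt_cat n.+1 m.+1;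
  tens1_linear : forall n m, linear (@tens1 n m);
  tens1_comp : forall n m l (a : rt_cat n m) (b : rt_cat m l),
    tens1 (comp a b) = comp (tens1 a) (tens1 b);
  tens1_star : forall n m (a : rt_cat n m), tens1 (star a) = star (tens1 a) }.

(* Tensoring shifts the objects to (k + n, k + m), in this order, so that
   the iteration typechecks by computation. *)
Fixpoint tensk (R : realType) (T : rtcat R) (n m : nat) (k : nat) (a : T n m) :
    T (k + n)%N (k + m)%N :=
  match k with
  | 0 => a
  | k'.+1 => tens1 (tensk k' a)
  end.

Definition homsets (R : realType) (T : rtcat R) := forall n m, set (T n m).

Definition subhom (R : realType) (T : rtcat R) (J K : homsets T) : Prop :=
  forall n m, J n m `<=` K n m.

Record is_ideal (R : realType) (T : rtcat R) (K : homsets T) : Prop := {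
  ideal0 : forall n m, K n m 0;
  idealD : forall n m (c : R[i]) a b, K n m a -> K n m b -> K n m (c *: a + b);
  ideal_closed : forall n m, closed (K n m);
  ideal_compl : forall n m l (a : T n m) (b : T m l), K m l b -> K n l (comp a b);
  ideal_compr : forall n m l (a : T n m) (b : T m l), K n m a -> K n l (comp a b) }.

Definition full (R : realType) (T : rtcat R) : homsets T := fun n m => setT.
Arguments full {R} T n m.

Definition Jof (R : realType) (T : rtcat R) (K : homsets T) : homsets T :=
  fun n m => [set a | K n m a /\ K n.+1 m.+1 (tens1 a)].
Arguments Jof {R T} K n m.

(** * The algebra DR(T) *)

(* (E, phi) is the inductive limit, in the category of Banach spaces, of
   the sequence T(r+k,r) along tens1. The family phi is indexed by all pairs
   (n,m), but only the values with n - m = k are meaningful. *)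
Record is_indlim (R : realType) (T : rtcat R) (k : int)
    (E : completeNormedModType R[i]) (phi : forall n m, T n m -> E) : Prop := {
  indlim_linear : forall n m, n%:Z = m%:Z + k -> linear (phi n m);
  indlim_tens1 : forall n m (a : T n m), n%:Z = m%:Z + k ->
    phi n.+1 m.+1 (tens1 a) = phi n m a;
  indlim_norm : forall n m (a : T n m), n%:Z = m%:Z + k ->
    (fun s => nrm (tensk s a)) @ \oo --> nrm (phi n m a);
  indlim_dense : dense
    [set x | exists n m (a : T n m), n%:Z = m%:Z + k /\ x = phi n m a] }.

(* The homogeneous components DR^(k)(T), with the product and involution
   induced by those of T: the continuous extensions of the operations on the
   images of the T(r+k,r). *)
Record dr_graded (R : realType) (T : rtcat R) := DRGraded {
  drk :> int -> completeNormedModType R[i];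
  dr_in : forall k n m, T n m -> drk k;
  dr_indlim : forall k, is_indlim k (dr_in k);
  dr_mul : forall j k, drk j -> drk k -> drk (j + k);
  dr_mul_linearl : forall j k (y : drk k), linear (fun x : drk j => dr_mul x y);
  dr_mul_linearr : forall j k (x : drk j), linear (fun y : drk k => dr_mul x y);
  dr_norm_mul : forall j k (x : drk j) (y : drk k), `|dr_mul x y| <= `|x| * `|y|;
  dr_mul_in : forall j k n m l (a : T n m) (b : T m l),
    n%:Z = m%:Z + j -> m%:Z = l%:Z + k ->
    dr_mul (dr_in j a) (dr_in k b) = dr_in (j + k) (comp a b);
  dr_star : forall k, drk k -> drk (- k);
  dr_star_antilinear : forall k (c : R[i]) (x y : drk k),
    dr_star (c *: x + y) = c^* *: dr_star x + dr_star y;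
  dr_norm_star : forall k (x : drk k), `|dr_star x| = `|x|;
  dr_star_in : forall k n m (a : T n m), n%:Z = m%:Z + k ->
    dr_star (dr_in k a) = dr_in (- k) (star a) }.

(* Elements of the algebraic direct sum of a family E are the x with
   [fin_supp x]. *)
Definition fin_supp (R : realType) (E : int -> completeNormedModType R[i])
    (x : forall k, E k) : Prop := finite_set [set k | x k != 0].

Definition dsum (R : realType) (E : int -> completeNormedModType R[i])
    (B : completeNormedModType R[i]) (emb : forall k, E k -> B)
    (x : forall k, E k) : B := \sum_(k \in [set: int]) emb k (x k).

(* A C*-algebra together with an embedding of the direct sum of the DR^(k)(T)
   which exhibits it as DR(T). The C*-norm on the direct sum is
   [fun x => `|dsum (@dr_emb) x|]; it is a norm by [dr_emb_inj] and invariant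
   under the circle action by [dr_circle]. *)
Record DR_model (R : realType) (T : rtcat R) := DRModel {
  dr_gr : dr_graded T;
  dr_alg :> cstarAlg R;
  dr_emb : forall k, dr_gr k -> dr_alg;
  dr_emb_linear : forall k, linear (@dr_emb k);
  dr_emb_mul : forall j k (x : dr_gr j) (y : dr_gr k),
    dr_emb (dr_mul x y) = cs_mul (dr_emb x) (dr_emb y);
  dr_emb_star : forall k (x : dr_gr k),
    dr_emb (dr_star x) = cs_star (dr_emb x);
  dr_emb_inj : forall x : (forall k, dr_gr k), fin_supp x ->
    dsum (@dr_emb) x = 0 -> forall k, x k = 0;
  dr_circle : forall (z : R[i]) (x : forall k, dr_gr k), `|z| = 1 -> fin_supp x ->
    `|dsum (@dr_emb) (fun k => z ^ k *: x k)| = `|dsum (@dr_emb) x|;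
  dr_dense : dense
    [set y | exists2 x : (forall k, dr_gr k), fin_supp x & y = dsum (@dr_emb) x] }.

(* The canonical maps T(n,m) -> DR^(n-m)(T) -> DR(T). *)
Definition dr_can (R : realType) (T : rtcat R) (D : DR_model T) (n m : nat)
    (a : T n m) : D :=
  dr_emb (dr_in (dr_gr D) (n%:Z - m%:Z) a).

(** * Right tensor representations and the algebra O_T(K,J) *)

(* A representation of K is given by maps defined on all of T(n,m), of which
   only the restrictions to K(n,m) are meaningful. *)
Record is_rt_rep (R : realType) (T : rtcat R) (K : homsets T) (B : cstarAlg R)
    (pi : forall n m, T n m -> B) : Prop := {
  rep_linear : forall n m (c : R[i]) a b, K n m a -> K n m b ->
    pi n m (c *: a + b) = c *: pi n m a + pi n m b;
  rep_star : forall n m a, K n m a -> cs_star (pi n m a) = pi m n (star a);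
  rep_mul : forall n m k l a b, K n m a -> K (k + m)%N l b ->
    cs_mul (pi n m a) (pi (k + m)%N l b) = pi (k + n)%N l (comp (tensk k a) b) }.

Definition coisometric (R : realType) (T : rtcat R) (J : homsets T)
    (B : cstarAlg R) (pi : forall n m, T n m -> B) : Prop :=
  forall n m a, J n m a -> pi n m a = pi n.+1 m.+1 (tens1 a).

Record O_model (R : realType) (T : rtcat R) (K J : homsets T) := OModel {
  o_alg :> cstarAlg R;
  o_rep : forall n m, T n m -> o_alg;
  o_rep_rt : is_rt_rep K (@o_rep);
  o_rep_coisometric : coisometric J (@o_rep);
  o_generated : forall S : set o_alg, is_cstar_subalg S ->
    (forall n m a, K n m a -> S (o_rep a)) -> S = setT;
  o_universal : forall (B : cstarAlg R) (pi : forall n m, T n m -> B),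
    is_rt_rep K pi -> coisometric J pi ->
    exists2 Psi : o_alg -> B, is_star_hom Psi &
      forall n m a, K n m a -> Psi (o_rep a) = pi n m a }.

(** * The right tensor C*-precategory K_J *)

(* [recast i j a] is a seen in T(i,j) if a is in T(n,m) with (n,m) = (i,j),
   and is 0 otherwise. *)
Definition recast (R : realType) (T : rtcat R) (n m i j : nat) (a : T n m) :
    T i j :=
  match @eqP _ n i, @eqP _ m j with
  | ReflectT en, ReflectT em =>
      ecast i (T i j) en (ecast j (T n j) em a)
  | _, _ => 0
  end.

Definition mat (R : realType) (T : rtcat R) := forall n m, T n m.

(* The matrix with single entry a at (n,m). *)
Definition iotaM (R : realType) (T : rtcat R) (n m : nat) (a : T n m) : mat T :=
  fun i j => recast i j a.

Definition mat_lin (R : realType) (T : rtcat R) (c : R[i]) (a b : mat T) : mat T :=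
  fun i j => c *: a i j + b i j.

Definition mat_star (R : realType) (T : rtcat R) (a : mat T) : mat T :=
  fun n m => star (a m n).

(* The product of M_T(K), obtained by expanding both factors in single-entry
   matrices: in the first sum the entries are a_{n,m} and b_{p,l} with
   p = j + m >= m, in the second one a_{n,m} and b_{p,l} with
   m = j.+1 + p > p. Both sums are finite for matrices with finitely many
   nonzero entries. *)
Definition mat_mul (R : realType) (T : rtcat R) (a b : mat T) : mat T :=
  fun i i' =>
    \sum_(t \in [set: nat * nat * nat * nat])
      (let: (n, m, l, j) := t in
       iotaM (comp (tensk j (a n m)) (b (j + m)%N l)) i i')
  + \sum_(t \in [set: nat * nat * nat * nat])
      (let: (n, p, l, j) := t in
       iotaM (comp (a n (j.+1 + p)%N) (tensk j.+1 (b p l))) i i').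

(* M(n,m), with n = r + k and m = r. Finiteness of the support is implied. *)
Definition inM (R : realType) (T : rtcat R) (K : homsets T) (n m : nat) :
    set (mat T) :=
  [set a | (forall i j, K i j (a i j)) /\
     (forall i j, a i j <> 0 -> i%:Z - j%:Z = n%:Z - m%:Z /\ (j <= m)%N)].

(* The sum x_s attached to a, with p = s + k: the condition i + k >= 0 is
   s <= p + i, and the summand a_{i+k,i} tensored s - i times lies in T(p,s). *)
Definition xsum (R : realType) (T : rtcat R) (a : mat T) (p s : nat) : T p s :=
  \sum_(0 <= i < s.+1 | (s <= p + i)%N)
    recast p s (tensk (s - i) (a (p + i - s)%N i)).

(* The norm of q_J(x) in T(n,m)/J(n,m). *)
Definition quot_nrm (R : realType) (T : rtcat R) (J : homsets T) (n m : nat)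
    (x : T n m) : R :=
  inf [set nrm (x - y) | y in J n m].

(* The seminorm of M(n,m), with n = r + k and m = r; the indices s < r for
   which s + k < 0 are left out. *)
Definition mat_seminorm (R : realType) (T : rtcat R) (J : homsets T)
    (n m : nat) (a : mat T) : R :=
  Num.max (\big[Num.max/0]_(s < m | (m <= n + s)%N)
             quot_nrm J (xsum a (n + s - m)%N s))
          (nrm (xsum a n m)).

(* A right tensor C*-precategory together with maps exhibiting it as
   K_J(n,m) = M(n,m) / (zero-seminorm elements), with the quotient norm and
   operations. Only the values of kj_q n m on M(n,m) are meaningful. *)
Record KJ_model (R : realType) (T : rtcat R) (K J : homsets T) := KJModel {
  kj_cat :> rtcat R;
  kj_q : forall n m, mat T -> kj_cat n m;
  kj_q_linear : forall n m (c : R[i]) a b, inM K n m a -> inM K n m b ->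
    kj_q n m (mat_lin c a b) = c *: kj_q n m a + kj_q n m b;
  kj_q_surj : forall n m (y : kj_cat n m), exists2 a, inM K n m a & kj_q n m a = y;
  kj_q_nrm : forall n m a, inM K n m a -> nrm (kj_q n m a) = mat_seminorm J n m a;
  kj_q_mul : forall n m l a b, inM K n m a -> inM K m l b ->
    kj_q n l (mat_mul a b) = comp (kj_q n m a) (kj_q m l b);
  kj_q_star : forall n m a, inM K n m a -> kj_q m n (mat_star a) = star (kj_q n m a);
  kj_q_tens1 : forall n m a, inM K n m a -> kj_q n.+1 m.+1 a = tens1 (kj_q n m a) }.

(* Main.v *)
(* A family pi of maps T(n,m) -> B respecting composition, involution and (x) 1
   extends to a *-homomorphism DR(T) -> B. Indeed, for *-homomorphisms f, k on
   a C*-algebra with ker f contained in ker k one has |k a| <= |f a|; on T(m,m)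
   this gives |pi a| <= |a| in DR(T), hence the same bound on every homogeneous
   element. For a sum y of elements of degrees between -N and N, averaging over
   the circle action yields |pi y| <= (2 N + 1) |y|, and applying this to the
   powers of y^* y removes the factor 2 N + 1. This extension property and the
   universal property of O_T(K,J) provide mutually inverse *-homomorphisms as
   soon as O_T(K,J) carries such a family: its universal representation if
   K = J = T, and for K_J the family sending the class of a matrix (a_(n,m)) to
   the sum of the images of its entries. *)
Require Import Defs.
From HB Require Import structures.
From mathcomp Require Import all_boot all_order all_algebra.
From mathcomp Require Import complex.
From mathcomp Require Import all_classical all_reals all_analysis.
From mathcomp Require Import ring lra zify.

Set Implicit Arguments.
Unset Strict Implicit.
Unset Printing Implicit Defensive.

Import Order.TTheory GRing.Theory Num.Theory numFieldNormedType.Exports.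

Local Open Scope classical_set_scope.
Local Open Scope ring_scope.
Local Open Scope complex_scope.

(** The bound |k a| <= |f a| is normally read off from spectral theory. Here the algebras have no
    unit and no functional calculus, so it is proved by hand. The conditions |x b| <= |b| and |b - x
    b| <= |b| for all b express |x| <= 1 and |1 - x| <= 1 in the unitization, square roots are
    limits of Newton iterations, and every sharp bound comes from one relation: commuting
    self-adjoint P, Q with P^2 + Q^2 = 2 c P satisfy |P - c| <= c and |Q| <= c. Two further
    obstacles shape the rest. The embedding of DR^(k)(T) in DR(T) is not given as contractive; this
    follows once degree 0 is known to be a C*-algebra. For K_J, the sum of the images of the entries
    must vanish on matrices of seminorm 0: coisometry on J makes the sums x_s telescope there. Its
    multiplicativity also needs products outside the range of the representation's product rule;
    they are reached by adjoints, which requires that the closed ideal K be self-adjoint. *)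

Local Notation comp := Defs.comp.
Local Notation compA := Defs.compA.
Local Notation "x ** y" := (cs_mul x y) (at level 38, left associativity).

(** * Norms and linear combinations *)

Section TrivialExtension.
Variables (K : fieldType) (V : lmodType K).

Definition triv_ext := (K * V)%type.
HB.instance Definition _ := GRing.Zmodule.on triv_ext.

Definition triv_one : triv_ext := (1, 0).
Definition triv_mul (x y : triv_ext) : triv_ext :=
  (x.1 * y.1, x.1 *: y.2 + y.1 *: x.2).

Fact triv_mulA : associative triv_mul.
Proof.
move=> x y z; rewrite /triv_mul /= mulrA; congr (_, _).
by rewrite !scalerDr !scalerA addrA (mulrC z.1) (mulrC z.1).
Qed.

Fact triv_mulC : commutative triv_mul.
Proof. by move=> x y; rewrite /triv_mul mulrC addrC. Qed.

Fact triv_mul1 : left_id triv_one triv_mul.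
Proof. by move=> [a u]; rewrite /triv_mul /= mul1r scale1r scaler0 addr0. Qed.

Fact triv_mulDl : left_distributive triv_mul +%R.
Proof.
move=> x y z; rewrite /triv_mul /= mulrDl; congr (_, _).
by rewrite /= scalerDl scalerDr addrACA.
Qed.

Fact triv_1neq0 : triv_one != 0.
Proof. by apply/eqP => -[] /eqP; rewrite oner_eq0. Qed.

HB.instance Definition _ := GRing.Zmodule_isComNzRing.Build triv_ext
  triv_mulA triv_mulC triv_mul1 triv_mulDl triv_1neq0.

Definition triv_vec (v : V) : triv_ext := (0, v).
Definition triv_scal (c : K) : triv_ext := (c, 0).

Lemma triv_vec_inj : injective triv_vec.
Proof. by move=> u v []. Qed.

Lemma triv_vecZ c v : triv_vec (c *: v) = triv_scal c * triv_vec v.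
Proof. by rewrite /triv_vec; congr (_, _); rewrite /= ?mulr0 // scale0r addr0. Qed.

Lemma triv_vecD u v : triv_vec (u + v) = triv_vec u + triv_vec v.
Proof. by congr (_, _); rewrite /= addr0. Qed.

Lemma triv_vecN v : triv_vec (- v) = - triv_vec v.
Proof. by congr (_, _); rewrite /= oppr0. Qed.

Lemma triv_vec0 : triv_vec 0 = 0.
Proof. by []. Qed.

Fact triv_scal_zmod : zmod_morphism triv_scal.
Proof. by move=> a b; congr (_, _); rewrite /= subr0. Qed.

Fact triv_scal_monoid : monoid_morphism triv_scal.
Proof. by split=> // a b; congr (_, _); rewrite /= !scaler0 addr0. Qed.

HB.instance Definition _ :=
  GRing.isZmodMorphism.Build K triv_ext triv_scal triv_scal_zmod.
HB.instance Definition _ :=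
  GRing.isMonoidMorphism.Build K triv_ext triv_scal triv_scal_monoid.

Definition triv_vecE := (triv_vecD, triv_vecN, triv_vecZ, triv_vec0).
End TrivialExtension.

(* An identity between linear combinations of vectors becomes an identity in
   the commutative ring K (+) V with V^2 = 0. *)
Ltac lmod := apply: triv_vec_inj; rewrite !triv_vecE; ring.

(** The order of [R[i]] makes every positive element real, so radii of balls and epsilons of limits
    can be taken in [R]. *)
Lemma gt0_realC (R : realType) (e : R[i]) : 0 < e -> e = (complex.Re e)%:C.
Proof. by case: e => a b; rewrite ltcE /= => /andP[/eqP ->]. Qed.

Section Norm.
Variables (R : realType) (V : normedModType R[i]).
Implicit Types (x y : V).

Lemma normE x : `|x| = (nrm x)%:C.
Proof.
have := normr_ge0 x; rewrite /nrm; case: `|x| => a b /=.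
by rewrite lecE /= => /andP[/eqP -> _].
Qed.

Lemma nrm_ge0 x : 0 <= nrm x.
Proof. by have := normr_ge0 x; rewrite normE -[0]/(0%:C) lecR. Qed.

Lemma nrm0 : nrm (0 : V) = 0.
Proof. by rewrite /nrm normr0. Qed.

Lemma nrm_eq0 x : nrm x = 0 -> x = 0.
Proof. by move=> h; apply/eqP; rewrite -normr_eq0 normE h. Qed.

Lemma nrmN x : nrm (- x) = nrm x.
Proof. by rewrite /nrm normrN. Qed.

Lemma nrm_distC x y : nrm (x - y) = nrm (y - x).
Proof. by rewrite /nrm distrC. Qed.

Lemma nrmD x y : nrm (x + y) <= nrm x + nrm y.
Proof. by rewrite -lecR rmorphD /= -!normE ler_normD. Qed.

Lemma nrmB x y : nrm (x - y) <= nrm x + nrm y.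
Proof. by rewrite -(nrmN y) nrmD. Qed.

Lemma nrmZ (c : R[i]) x : nrm (c *: x) = complex.Re `|c| * nrm x.
Proof.
rewrite /nrm normrZ normE /=; case: `|c| => a b /=.
by rewrite mulr0 subr0.
Qed.

Lemma nrmZ1 (c : R[i]) x : `|c| = 1 -> nrm (c *: x) = nrm x.
Proof. by move=> h; rewrite nrmZ h mul1r. Qed.

Lemma nrmZR (c : R) x : 0 <= c -> nrm (c%:C *: x) = c * nrm x.
Proof. by move=> c0; rewrite nrmZ ger0_norm // -[0]/(0%:C) lecR. Qed.

Lemma nrm_double x : nrm (x + x) = 2 * nrm x.
Proof.
by rewrite -mulr2n -scaler_nat -(rmorph_nat (@real_complex R)) nrmZR.
Qed.

Lemma ler_nrm_dist x y : `|nrm x - nrm y| <= nrm (x - y).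
Proof.
rewrite ler_norml; apply/andP; split.
  by have := nrmD (y - x) x; rewrite subrK -(nrm_distC x); lra.
by have := nrmD (x - y) y; rewrite subrK; lra.
Qed.

Lemma nrm_sum (I : Type) (r : seq I) (P : pred I) (F : I -> V) :
  nrm (\sum_(i <- r | P i) F i) <= \sum_(i <- r | P i) nrm (F i).
Proof.
elim/big_ind2: _ => [|u a v b ua vb|//]; first by rewrite nrm0.
by apply: le_trans (nrmD _ _) _; rewrite lerD.
Qed.

Lemma cvg_nrmP (T : Type) (F : set_system T) {FF : Filter F} (u : T -> V) (l : V) :
  (u @ F --> l) <-> forall e : R, 0 < e -> \forall n \near F, nrm (l - u n) < e.
Proof.
rewrite cvgrPdist_lt; split=> h e e0.
  have /h : 0 < e%:C by rewrite -[0]/(0%:C) ltcR.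
  by apply: filterS => n; rewrite normE ltcR.
have eE := gt0_realC e0.
have /h : 0 < complex.Re e by move: e0; rewrite {1}eE -[0]/(0%:C) ltcR.
by apply: filterS => n; rewrite normE {2}eE ltcR.
Qed.

Lemma cvg_nrm (T : Type) (F : set_system T) {FF : Filter F} (u : T -> V) (l : V) :
  u @ F --> l -> nrm (u x) @[x --> F] --> nrm l.
Proof.
move=> /cvg_nrmP h; apply/cvgrPdist_lt => e /h.
by apply: filterS => n; apply: le_lt_trans (ler_nrm_dist _ _).
Qed.

Lemma nrm_cvg_le (T : Type) (F : set_system T) {FF : ProperFilter F}
    (u : T -> V) (l : V) (c : R) :
  u @ F --> l -> (forall n, nrm (u n) <= c) -> nrm l <= c.
Proof.
move=> ul ub.
have h : nrm (u x) @[x --> F] --> nrm l by exact: cvg_nrm.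
apply: (closed_cvg (fun r : R => r <= c) _ _ _ h); first exact: closed_le.
exact: nearW.
Qed.

Lemma cvg_nrm0 (T : Type) (F : set_system T) {FF : Filter F} (u : T -> V)
    (l : V) (c : T -> R) :
  (forall n, nrm (l - u n) <= c n) -> c @ F --> 0 -> u @ F --> l.
Proof.
move=> h /cvgrPdist_lt c0; apply/cvg_nrmP => e /c0; apply: filterS => n.
rewrite sub0r normrN; apply: le_lt_trans; apply: le_trans (h n) (ler_norm _).
Qed.

Lemma cvg_normed_unique (T : Type) (F : set_system T) {FF : ProperFilter F}
    (u : T -> V) (x y : V) : u @ F --> x -> u @ F --> y -> x = y.
Proof. by move=> ux uy; apply: (cvg_unique (@norm_hausdorff _ V) ux uy). Qed.

Lemma closed_nrmP (S : set V) x : closed S ->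
  (forall e : R, 0 < e -> exists2 y, S y & nrm (x - y) < e) -> S x.
Proof.
move=> cS h; apply: cS => W /nbhs_ballP[e /= e0 eW].
have eE := gt0_realC e0.
have /h[y Sy xy] : 0 < complex.Re e by move: e0; rewrite {1}eE -[0]/(0%:C) ltcR.
by exists y; split=> //; apply: eW; rewrite -ball_normE /ball_ /= normE eE ltcR.
Qed.

Lemma dense_nrmP (S : set V) : dense S -> forall x (e : R), 0 < e ->
  exists2 y, S y & nrm (x - y) < e.
Proof.
move=> dS x e e0; have e0' : 0 < e%:C by rewrite -[0]/(0%:C) ltcR.
have [||y [+ Sy]] := dS (ball x e%:C) _ _.
- by exists x; exact: ballxx.
- exact: ball_open.
- by rewrite -ball_normE /ball_ /= normE ltcR => xy; exists y.
Qed.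
End Norm.

Lemma nrm_cauchy_cvg (R : realType) (V : completeNormedModType R[i])
    (u : nat -> V) (t : nat -> R) :
  (forall n p, (n <= p)%N -> nrm (u p - u n) <= t n) -> t @ \oo --> 0 ->
  exists l : V, u @ \oo --> l.
Proof.
move=> h /cvgrPdist_lt t0; exists (lim (u @ \oo)); apply/cauchy_cvgP.
apply/cauchy_exP => e e0.
have eE := gt0_realC e0.
have /t0 [N _ /(_ N (leqnn _))] : 0 < complex.Re e.
  by move: e0; rewrite {1}eE -[0]/(0%:C) ltcR.
rewrite sub0r normrN => tN; exists (u N), N => // n Nn.
rewrite -ball_normE /ball_ /= normE eE ltcR nrm_distC.
by apply: le_lt_trans (h _ _ Nn) (le_lt_trans (ler_norm _) tN).
Qed.

(** * C*-algebras without functional calculus *)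

Section LinearMaps.
Variables (K : fieldType) (U V : lmodType K) (f : U -> V).
Hypothesis lf : linear f.

Lemma linear_D x y : f (x + y) = f x + f y.
Proof. by have := lf 1 x y; rewrite !scale1r. Qed.

Lemma linear_0 : f 0 = 0.
Proof. by apply: (addrI (f 0)); rewrite -linear_D !addr0. Qed.

Lemma linear_Z c x : f (c *: x) = c *: f x.
Proof. by have := lf c x 0; rewrite linear_0 !addr0. Qed.

Lemma linear_N x : f (- x) = - f x.
Proof. by rewrite -scaleN1r linear_Z scaleN1r. Qed.

Lemma linear_B x y : f (x - y) = f x - f y.
Proof. by rewrite linear_D linear_N. Qed.

Lemma linear_big (I : Type) (r : seq I) (P : pred I) (F : I -> U) :
  f (\sum_(i <- r | P i) F i) = \sum_(i <- r | P i) f (F i).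
Proof. exact: (big_morph f linear_D linear_0). Qed.
End LinearMaps.

Lemma scalCR_conj (R : realType) (c : R) : Num.conj c%:C = c%:C.
Proof. by rewrite conj_Creal //; apply/Creal_ImP; rewrite -complexIm. Qed.

Section CstarTheory.
Variables (R : realType) (A : cstarAlg R).
Implicit Types (x y z b : A) (c : R[i]).

Lemma cs_mulDl x y z : (x + y) ** z = x ** z + y ** z.
Proof. exact: (linear_D (cs_mul_linearl z)). Qed.
Lemma cs_mulDr z x y : z ** (x + y) = z ** x + z ** y.
Proof. exact: (linear_D (cs_mul_linearr z)). Qed.
Lemma cs_mulZl c x z : (c *: x) ** z = c *: (x ** z).
Proof. exact: (linear_Z (cs_mul_linearl z)). Qed.
Lemma cs_mulZr c x z : z ** (c *: x) = c *: (z ** x).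
Proof. exact: (linear_Z (cs_mul_linearr z)). Qed.
Lemma cs_mulNl x z : (- x) ** z = - (x ** z).
Proof. exact: (linear_N (cs_mul_linearl z)). Qed.
Lemma cs_mulNr x z : z ** (- x) = - (z ** x).
Proof. exact: (linear_N (cs_mul_linearr z)). Qed.
Lemma cs_mul0l x : 0 ** x = 0.
Proof. exact: (linear_0 (cs_mul_linearl x)). Qed.
Lemma cs_mul0r x : x ** 0 = 0.
Proof. exact: (linear_0 (cs_mul_linearr x)). Qed.

Definition cs_mulE :=
  (cs_mulDl, cs_mulDr, cs_mulNl, cs_mulNr, cs_mulZl, cs_mulZr, cs_mulA).

Lemma cs_starD x y : cs_star (x + y) = cs_star x + cs_star y.
Proof. by have := cs_star_antilinear 1 x y; rewrite conjC1 !scale1r. Qed.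
Lemma cs_star0 : cs_star (0 : A) = 0.
Proof. by apply: (addrI (cs_star 0)); rewrite -cs_starD !addr0. Qed.
Lemma cs_starZ c x : cs_star (c *: x) = Num.conj c *: cs_star x.
Proof. by have := cs_star_antilinear c x 0; rewrite cs_star0 !addr0. Qed.
Lemma cs_starZR (r : R) x : cs_star (r%:C *: x) = r%:C *: cs_star x.
Proof. by rewrite cs_starZ scalCR_conj. Qed.
Lemma cs_starN x : cs_star (- x) = - cs_star x.
Proof. by rewrite -scaleN1r cs_starZ rmorphN1 scaleN1r. Qed.

Lemma nrm_mul x y : nrm (x ** y) <= nrm x * nrm y.
Proof. by rewrite -lecR rmorphM /= -!normE cs_norm_mul. Qed.

Lemma nrm_star_mul x : nrm (cs_star x ** x) = nrm x ^+ 2.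
Proof.
apply: complexI; rewrite rmorphXn /= -!normE; exact: cs_norm_star_mul.
Qed.

Lemma nrm_star x : nrm (cs_star x) = nrm x.
Proof.
have le y : nrm y <= nrm (cs_star y).
  have := nrm_mul (cs_star y) y; rewrite nrm_star_mul.
  have := nrm_ge0 y; rewrite le_eqVlt => /orP[/eqP <- _|y0]; first exact: nrm_ge0.
  by rewrite expr2 ler_pM2r.
by apply/eqP; rewrite eq_le le -{2}(cs_starK x) le.
Qed.

Lemma nrm_mulJ x : nrm (x ** cs_star x) = nrm x ^+ 2.
Proof. by rewrite -{1}(cs_starK x) nrm_star_mul nrm_star. Qed.

Lemma cs_star_mul_eq0 x : cs_star x ** x = 0 -> x = 0.
Proof.
move=> h; apply: nrm_eq0; apply/eqP.
by rewrite -sqrf_eq0 -nrm_star_mul h nrm0.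
Qed.

(** Testing on b = x^* gives |x|^2 <= k |x|. Estimates made on left multiplication operators, where
    elements of the unitization live, thus return to A. *)
Lemma nrm_le_mulr x (k : R) : 0 <= k ->
  (forall b, nrm (x ** b) <= k * nrm b) -> nrm x <= k.
Proof.
move=> k0 h; have := h (cs_star x); rewrite nrm_mulJ nrm_star.
have := nrm_ge0 x; rewrite le_eqVlt => /orP[/eqP <- //|x0].
by rewrite expr2 ler_pM2r.
Qed.

Lemma cvg_cs_mul (T : Type) (F : set_system T) {FF : ProperFilter F}
    (u v : T -> A) x y :
  u @ F --> x -> v @ F --> y -> (u t ** v t) @[t --> F] --> x ** y.
Proof.
move=> ux vy; apply: (cvg_nrm0 (c :=
  fun t => nrm (x - u t) * nrm y + nrm (u t) * nrm (y - v t))).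
  move=> t; rewrite (_ : x ** y - _ = (x - u t) ** y + u t ** (y - v t)).
    by apply: le_trans (nrmD _ _) _; rewrite lerD // nrm_mul.
  by rewrite cs_mulDl cs_mulDr cs_mulNl cs_mulNr addrA subrK.
have z (w : T -> A) l : w @ F --> l -> nrm (l - w t) @[t --> F] --> 0.
  move=> wl; rewrite -(@nrm0 _ A) -(subrr l); apply: cvg_nrm.
  by apply: cvgB => //; exact: cvg_cst.
have -> : 0 = 0 * nrm y + nrm x * 0 :> R by rewrite mul0r mulr0 addr0.
apply: cvgD; apply: cvgM; [exact: z | exact: cvg_cst | exact: cvg_nrm | exact: z].
Qed.

Lemma cvg_cs_star (T : Type) (F : set_system T) {FF : Filter F} (u : T -> A) x :
  u @ F --> x -> cs_star (u t) @[t --> F] --> cs_star x.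
Proof.
move=> /cvg_nrmP h; apply/cvg_nrmP => e /h; apply: filterS => t.
by rewrite -cs_starN -cs_starD nrm_star.
Qed.

(* The operators v = (P - c) + i Q and (P - c) - i Q satisfy v^* v = c^2. *)
Lemma pythagoras (P Q : A) (c : R) : 0 <= c -> cs_star P = P -> cs_star Q = Q ->
  P ** Q = Q ** P -> P ** P + Q ** Q = (2 * c)%:C *: P ->
  forall b, nrm (P ** b - c%:C *: b) <= c * nrm b /\ nrm (Q ** b) <= c * nrm b.
Proof.
move=> c0 sP sQ PQ sq b.
set e := P ** b - c%:C *: b; set f := Q ** b.
have unitary (s : R[i]) : Num.conj s = - s -> s * s = - 1 -> nrm (e + s *: f) = c * nrm b.
  move=> sJ ss; apply/eqP; rewrite -(@eqrXn2 _ 2) ?mulr_ge0 ?nrm_ge0 //.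
  rewrite -nrm_star_mul exprMn -nrm_star_mul -nrmZR ?sqr_ge0 //; apply/eqP.
  congr nrm.
  rewrite cs_starD cs_starZ sJ /e /f cs_starD cs_starN cs_starZR !cs_star_mul sP sQ.
  rewrite !cs_mulE.
  have -> : cs_star b ** P ** P = cs_star b ** ((2 * c)%:C *: P - Q ** Q).
    by rewrite -sq addrK cs_mulA.
  rewrite -[_ ** P ** Q]cs_mulA PQ !cs_mulE.
  have -> : (c ^+ 2)%:C = c%:C * c%:C by rewrite rmorphXn expr2.
  have -> : (2 * c)%:C = 2 * c%:C by rewrite rmorphM /= rmorph_nat.
  rewrite [s *: (- s *: _)]scalerA mulrN ss opprK scale1r.
  lmod.
have i1 := unitary 'i%R (conjCi _) (etrans (esym (expr2 _)) (sqrCi _)).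
have i2 : nrm (e + (- 'i%R) *: f) = c * nrm b.
  by apply: unitary; rewrite ?rmorphN /= ?conjCi // mulrNN -expr2 sqrCi.
(* 2 e and 2 i f are the sum and the difference of two vectors of norm c |b|. *)
split; rewrite -(@ler_pM2l _ 2) //.
  rewrite -nrm_double.
  have -> : e + e = (e + 'i%R *: f) + (e + (- 'i%R) *: f) by lmod.
  by apply: le_trans (nrmD _ _) _; rewrite i1 i2; lra.
rewrite -nrm_double -(@nrmZ1 _ _ 'i%R) ?normCi //.
have -> : 'i%R *: (f + f) = (e + 'i%R *: f) - (e + (- 'i%R) *: f) by lmod.
by apply: le_trans (nrmB _ _) _; rewrite i1 i2; lra.
Qed.
End CstarTheory.

Lemma cvg_realC (R : realType) (T : Type) (F : set_system T) {FF : Filter F}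
    (u : T -> R) (l : R) :
  u @ F --> l -> ((u t)%:C : R[i]^o) @[t --> F] --> (l%:C : R[i]^o).
Proof.
move=> ul; apply: (@cvg_nrm0 _ (R[i]^o) _ _ _ _ _ (fun t => `|l - u t|)).
  move=> t; rewrite -rmorphB /nrm /=.
  by rewrite expr0n /= addr0 sqrtr_sqr.
rewrite -(normr0 R) -(subrr l); apply: cvg_norm.
by apply: cvgB => //; exact: cvg_cst.
Qed.

(** * Square roots by Newton iteration *)

Section NewtonIteration.
Variable R : realType.

(** Scalar majorant of the iteration [newton_a]. Its limit 1 is a double root of L^2 - 2 L + 1, so
    convergence comes from monotonicity and not from a contraction rate. *)
Fixpoint newton_t (n : nat) : R :=
  if n is k.+1 then (1 + newton_t k ^+ 2) / 2 else 0.

Lemma newton_t_ge0 n : 0 <= newton_t n.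
Proof. by case: n => //= n; rewrite divr_ge0 // addr_ge0 // sqr_ge0. Qed.

Lemma newton_t_le1 n : newton_t n <= 1.
Proof.
by elim: n => //= n ih; have := newton_t_ge0 n; move: ih; nra.
Qed.

Lemma newton_t_leS n : newton_t n <= newton_t n.+1.
Proof. by rewrite /=; have := sqr_ge0 (1 - newton_t n); nra. Qed.

Lemma newton_t_homo : {homo newton_t : n p / (n <= p)%N >-> n <= p}.
Proof. by apply: homo_leq => //; [exact: le_trans|exact: newton_t_leS]. Qed.

Lemma newton_t_cvg : newton_t @ \oo --> (1 : R).
Proof.
have ub : has_ubound (range newton_t).
  by exists 1 => _ [n _ <-]; exact: newton_t_le1.
have := nondecreasing_cvgn newton_t_homo ub.
set L := sup _ => tL.
have tL' : newton_t n.+1 @[n --> \oo] --> L by rewrite cvg_shiftS.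
have tL2 : newton_t n.+1 @[n --> \oo] --> (1 + L * L) / 2.
  apply: cvgM; last exact: cvg_cst.
  apply: cvgD; first exact: cvg_cst.
  by under eq_fun do rewrite expr2; apply: cvgM.
have e := cvg_unique (@norm_hausdorff _ _) tL' tL2.
suff <- : L = 1 by [].
have e2 : L * 2 = 1 + L * L by rewrite {1}e divfK.
apply/eqP; rewrite -subr_eq0 -sqrf_eq0; apply/eqP.
by have -> : (L - 1) ^+ 2 = 1 + L * L - L * 2 by [ring]; rewrite e2 subrr.
Qed.

Variables (A : cstarAlg R) (g : R) (x : A).

Fixpoint newton_a (n : nat) : A :=
  if n is k.+1 then
    (2^-1)%:C *: (x + (2 * (g * newton_t k))%:C *: newton_a k
                  + newton_a k ** newton_a k)
  else 0.

(** Left multiplication by the element g t_n + a_n of the unitization. All estimates are made on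
    these operators; g^2 = g lets the scalar parts follow the same recursion. *)
Let Y n (b : A) := (g * newton_t n)%:C *: b + newton_a n ** b.

Hypotheses (g0 : 0 <= g) (gg : g * g = g) (sx : cs_star x = x).
Hypothesis x1 : forall b, nrm (g%:C *: b + x ** b) <= nrm b.

Let g1 : g <= 1. Proof. by move: gg g0; nra. Qed.

Lemma newton_aS n : newton_a n.+1 + newton_a n.+1 =
  x + (2 * (g * newton_t n))%:C *: newton_a n + newton_a n ** newton_a n.
Proof.
rewrite /= -scalerDl -rmorphD /=.
by rewrite (_ : 2^-1 + 2^-1 = 1) ?scale1r //; lra.
Qed.

Let YD n b c : Y n (b + c) = Y n b + Y n c.
Proof. by rewrite /Y cs_mulDr; lmod. Qed.
Let YN n b : Y n (- b) = - Y n b.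
Proof. by rewrite /Y cs_mulNr; lmod. Qed.

Let YS n b : Y n.+1 b + Y n.+1 b = (g%:C *: b + x ** b) + Y n (Y n b).
Proof.
rewrite /Y addrACA -cs_mulDl newton_aS -scalerDl -rmorphD /=.
have -> : g * ((1 + newton_t n ^+ 2) / 2) + g * ((1 + newton_t n ^+ 2) / 2) =
          g + (g * newton_t n) * (g * newton_t n).
  by rewrite mulrACA gg; lra.
set c := g * newton_t n.
rewrite !cs_mulE !rmorphD !rmorphM /= rmorph_nat.
lmod.
Qed.

Let Y_le n b : nrm (Y n b) <= newton_t n * nrm b.
Proof.
elim: n b => [|n ih] b; first by rewrite /Y /= cs_mul0l mulr0 scale0r addr0 nrm0 mul0r.
rewrite -(@ler_pM2l _ 2) // -nrm_double YS.
apply: le_trans (nrmD _ _) _.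
apply: le_trans (lerD (x1 b) (le_trans (ih _) (ler_wpM2l (newton_t_ge0 n) (ih _)))) _.
by rewrite /=; have := nrm_ge0 b; nra.
Qed.

Let YD_le n b : nrm (Y n.+1 b - Y n b) <= (newton_t n.+1 - newton_t n) * nrm b.
Proof.
elim: n b => [|n ih] b.
  by rewrite {2}/Y /= cs_mul0l mulr0 scale0r addr0 !subr0; exact: (Y_le 1).
rewrite -(@ler_pM2l _ 2) // -nrm_double.
(* u^2 - v^2 = u (u - v) + (u - v) v without commutation; the majorant satisfies the same identity,
   so the estimate closes with equality. *)
have -> : Y n.+2 b - Y n.+1 b + (Y n.+2 b - Y n.+1 b) =
          Y n.+1 (Y n.+1 b - Y n b) + (Y n.+1 (Y n b) - Y n (Y n b)).
  rewrite addrACA YS -opprD YS (YD n.+1 (Y n.+1 b)) (YN n.+1 (Y n b)).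
  by lmod.
apply: le_trans (nrmD _ _) _.
apply: le_trans (lerD (le_trans (Y_le _ _) (ler_wpM2l (newton_t_ge0 _) (ih _))) (ih _)) _.
have h := Y_le n b.
have d0 : 0 <= newton_t n.+1 - newton_t n by rewrite subr_ge0 newton_t_leS.
apply: le_trans (lerD (lexx _) (ler_wpM2l d0 h)) _.
rewrite [newton_t n.+2]/= -/(newton_t n.+1).
set t' := newton_t n.+1; set t := newton_t n.
have t'E : t' = (1 + t ^+ 2) / 2 by [].
by rewrite le_eqVlt; apply/orP; left; apply/eqP; rewrite t'E; field.
Qed.

Let Y_dist n p b : (n <= p)%N ->
  nrm (Y p b - Y n b) <= (newton_t p - newton_t n) * nrm b.
Proof.
elim: p => [|p ih]; first by rewrite leqn0 => /eqP ->; rewrite !subrr nrm0 mul0r.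
rewrite leq_eqVlt => /orP[/eqP ->|]; first by rewrite !subrr nrm0 mul0r.
rewrite ltnS => /ih h.
rewrite -(subrKA (Y p b)); apply: le_trans (nrmD _ _) _.
by have := YD_le p b; move: h; lra.
Qed.

(** a_p - a_n is the difference of the operators minus its scalar part g (t_p - t_n); each of the
    two costs at most 1 - t_n, whence the factor 2. *)
Let a_dist n p : (n <= p)%N ->
  nrm (newton_a p - newton_a n) <= 2 * (1 - newton_t n).
Proof.
move=> np; have t1 := newton_t_le1 n; apply: nrm_le_mulr => [|b]; first lra.
have -> : (newton_a p - newton_a n) ** b =
   (Y p b - Y n b) - (g * (newton_t p - newton_t n))%:C *: b.
  by rewrite /Y cs_mulDl cs_mulNl !(rmorphM, rmorphB) /=; lmod.
have tt : 0 <= newton_t p - newton_t n by rewrite subr_ge0 newton_t_homo.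
apply: le_trans (nrmB _ _) _; rewrite nrmZR ?mulr_ge0 //.
have := Y_dist b np; have := nrm_ge0 b; have := newton_t_le1 p.
move=> tp1 B0 h.
have h1 : 0 <= (1 - g) * ((newton_t p - newton_t n) * nrm b).
  by rewrite !mulr_ge0 // subr_ge0.
have h2 : 0 <= (1 - newton_t p) * nrm b by rewrite mulr_ge0 // subr_ge0.
by move: h h1 h2; nra.
Qed.

Let a_star n : cs_star (newton_a n) = newton_a n.
Proof.
elim: n => [|n ih]; first exact: cs_star0.
by rewrite /= cs_starZR !cs_starD cs_star_mul cs_starZR sx ih.
Qed.

Let a_comm w n : x ** w = w ** x -> newton_a n ** w = w ** newton_a n.
Proof.
move=> xw; elim: n => [|n ih]; first by rewrite cs_mul0l cs_mul0r.
rewrite /= cs_mulZl cs_mulZr !(cs_mulDl, cs_mulDr) cs_mulZl cs_mulZr xw ih.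
by rewrite -cs_mulA ih cs_mulA ih -cs_mulA.
Qed.

(* In the unitization y = g t_n + a_n is the sequence y' = (g + x + y^2) / 2.
   For g = 1 it gives the positive square root - a of - x without leaving the
   algebra, and for g = 0 the small solution a of 2 a = x + a^2. *)
Lemma newton_sqrt : exists a : A, [/\ cs_star a = a,
  forall w, x ** w = w ** x -> a ** w = w ** a,
  a + a = x + (2 * g)%:C *: a + a ** a &
  forall b, nrm (g%:C *: b + a ** b) <= nrm b].
Proof.
have [|a aP] := nrm_cauchy_cvg a_dist.
  have -> : 0 = 2 * (1 - 1) :> R by rewrite subrr mulr0.
  by apply: cvgM; [exact: cvg_cst|]; apply: cvgB; [exact: cvg_cst|exact: newton_t_cvg].
have tP (c : R) : ((c * newton_t n)%:C : R[i]^o) @[n --> \oo] --> (c%:C : R[i]^o).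
  apply: cvg_realC; rewrite -[X in _ --> X]mulr1.
  by apply: cvgM; [exact: cvg_cst|exact: newton_t_cvg].
exists a; split.
- apply/esym/(cvg_normed_unique aP).
  rewrite (_ : newton_a = fun n => cs_star (newton_a n)); first exact: cvg_cs_star.
  by apply/funext => n; rewrite a_star.
- move=> w xw.
  have l1 : newton_a n ** w @[n --> \oo] --> a ** w.
    by apply: cvg_cs_mul => //; exact: cvg_cst.
  apply: (cvg_normed_unique l1).
  rewrite (_ : (fun n => _) = fun n => w ** newton_a n).
    by apply: cvg_cs_mul => //; exact: cvg_cst.
  by apply/funext => n; rewrite (a_comm _ xw).
- have aP' : newton_a n.+1 @[n --> \oo] --> a by rewrite cvg_shiftS.
  have l1 : newton_a n.+1 + newton_a n.+1 @[n --> \oo] --> a + a by exact: cvgD.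
  apply: (cvg_normed_unique l1).
  under eq_fun do rewrite newton_aS mulrA.
  apply: cvgD; last exact: cvg_cs_mul.
  by apply: cvgD; [exact: cvg_cst|apply: cvgZ].
- move=> b; apply: (@nrm_cvg_le _ _ _ \oo _ (Y ^~ b)).
    apply: cvgD; first by apply: cvgZ => //; exact: cvg_cst.
    by apply: cvg_cs_mul => //; exact: cvg_cst.
  move=> n; apply: le_trans (Y_le _ _) _.
  by rewrite ler_piMl ?nrm_ge0 ?newton_t_le1.
Qed.
End NewtonIteration.

Section Commutation.
Variables (R : realType) (A : cstarAlg R).
Implicit Types x y z : A.

Definition cs_comm x y := x ** y = y ** x.

Lemma cs_commC x y : cs_comm x y -> cs_comm y x.
Proof. by []. Qed.
Lemma cs_commD x y z : cs_comm x y -> cs_comm x z -> cs_comm x (y + z).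
Proof. by rewrite /cs_comm cs_mulDl cs_mulDr => -> ->. Qed.
Lemma cs_commZ (c : R[i]) x y : cs_comm x y -> cs_comm x (c *: y).
Proof. by rewrite /cs_comm cs_mulZl cs_mulZr => ->. Qed.
Lemma cs_commN x y : cs_comm x y -> cs_comm x (- y).
Proof. by rewrite /cs_comm cs_mulNl cs_mulNr => ->. Qed.
Lemma cs_commM x y z : cs_comm x y -> cs_comm x z -> cs_comm x (y ** z).
Proof. by rewrite /cs_comm cs_mulA => -> h; rewrite -cs_mulA h cs_mulA. Qed.

Lemma cs_comm_sqr x y : cs_comm x y -> x ** y ** (x ** y) = x ** x ** (y ** y).
Proof. by move=> xy; rewrite cs_mulA -[x ** y ** x]cs_mulA -xy !cs_mulA. Qed.

(** y is 1 - sqrt (1 - x): the equation (1 - y)^2 = 1 - x, once expanded, no longer mentions the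
    unit. *)
Lemma sqrt_contraction x : cs_star x = x -> (forall b, nrm (x ** b) <= nrm b) ->
  exists y, [/\ cs_star y = y, forall w, cs_comm x w -> cs_comm y w
    & y + y = x + y ** y].
Proof.
move=> sx x1; have x1' b : nrm (0%:C *: b + x ** b) <= nrm b.
  by rewrite scale0r add0r.
have [y [sy cy yy _]] := newton_sqrt (lexx 0) (mulr0 0) sx x1'.
exists y; split => //.
by rewrite yy mulr0 scale0r addr0.
Qed.

(** The bound |1 - x| <= 1 is the substitute for positivity. Newton iteration for - x ends at 1 + a
    with (- a)^2 = x, so r = - a; since 1 - r = 1 + a is again a contraction, the lemma applies to r
    in turn. *)
Lemma sqrt_positive x :
  cs_star x = x -> (forall b, nrm (b - x ** b) <= nrm b) ->
  exists r, [/\ cs_star r = r, forall w, cs_comm x w -> cs_comm r w,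
    r ** r = x & forall b, nrm (b - r ** b) <= nrm b].
Proof.
move=> sx x1; have x1' b : nrm (1%:C *: b + (- x) ** b) <= nrm b.
  by rewrite scale1r cs_mulNl.
have sNx : cs_star (- x) = - x by rewrite cs_starN sx.
have [a [sa ca aa a1]] := newton_sqrt ler01 (mulr1 1) sNx x1'.
exists (- a); split => [|w xw||b].
- by rewrite cs_starN sa.
- apply/cs_commC/cs_commN/cs_commC/ca.
  by rewrite cs_mulNl cs_mulNr xw.
- rewrite cs_mulNl cs_mulNr opprK.
  apply/eqP; rewrite -subr_eq0; apply/eqP; apply: (addrI (a + a)).
  by rewrite addr0 [RHS]aa mulr1 rmorph_nat; lmod.
- by have := a1 b; rewrite scale1r cs_mulNl opprK.
Qed.

(** For y = 1 - sqrt (1 - x^2), the equation 2 y = y^2 + x^2 is the relation of [pythagoras] for the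
    pair y, x with c = 1. Hence |1 - y| <= 1, and 1 - x^2 = (1 - y)^2. *)
Lemma sub_sqr_contraction x : cs_star x = x ->
  (forall b, nrm (x ** b) <= nrm b) -> forall b, nrm (b - x ** x ** b) <= nrm b.
Proof.
move=> sx x1 b; have sxx : cs_star (x ** x) = x ** x by rewrite cs_star_mul sx.
have [|y [sy cy yy]] := sqrt_contraction sxx.
  by move=> b'; rewrite -cs_mulA; apply: le_trans (x1 _) (x1 _).
have /cy/cs_commC xy : cs_comm (x ** x) x by rewrite /cs_comm cs_mulA.
have /= h := @pythagoras _ _ y x 1 ler01 sy sx (esym xy).
have {}h z : nrm (z - y ** z) <= nrm z.
  have [|+ _] := h _ z.
    by rewrite addrC -yy mulr1 rmorph_nat scaler_nat mulr2n.
  by rewrite scale1r mul1r nrm_distC.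
have -> : b - x ** x ** b = (b - y ** b) - y ** (b - y ** b).
  have -> : x ** x = y + y - y ** y by rewrite yy addrK.
  by rewrite !cs_mulE; lmod.
exact: le_trans (h _) (h _).
Qed.
End Commutation.

(** * Norms and kernels of *-homomorphisms *)

Section StarHoms.
Variables (R : realType) (A B : cstarAlg R) (f : A -> B).
Hypothesis hf : is_star_hom f.

Lemma star_homD x y : f (x + y) = f x + f y.
Proof. exact: (linear_D (star_hom_linear hf)). Qed.
Lemma star_homZ c x : f (c *: x) = c *: f x.
Proof. exact: (linear_Z (star_hom_linear hf)). Qed.
Lemma star_homN x : f (- x) = - f x.
Proof. exact: (linear_N (star_hom_linear hf)). Qed.
Lemma star_hom0 : f 0 = 0.
Proof. exact: (linear_0 (star_hom_linear hf)). Qed.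
Lemma star_homM x y : f (x ** y) = f x ** f y.
Proof. exact: star_hom_mul. Qed.
Lemma star_hom_sa x : cs_star x = x -> cs_star (f x) = f x.
Proof. by rewrite -star_hom_star // => ->. Qed.
Lemma star_hom_comm x y : cs_comm x y -> cs_comm (f x) (f y).
Proof. by rewrite /cs_comm -!star_homM => ->. Qed.
End StarHoms.

Section KernelDomination.
Variables (R : realType) (A B C : cstarAlg R) (f : A -> B) (k : A -> C).
Hypotheses (hf : is_star_hom f) (hk : is_star_hom k).
Hypothesis ker : forall a, f a = 0 -> k a = 0.

(* With p = h^2 and q = l (p^2 - c p), f (q + |q|) = 0 because f p is bounded
   by c; hence k q = - |k q|, which bounds k p by c. *)
Lemma ker_nrm_sqr (h : A) (c : R) : cs_star h = h -> 0 < c ->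
  nrm (f (h ** h)) <= c -> nrm (k (h ** h)) <= c.
Proof.
move=> sh c0 fc; set p := h ** h in fc *.
have sp : cs_star p = p by rewrite cs_star_mul sh.
(* The factor l makes q a contraction, as the square roots below require. *)
pose q0 := p ** p - c%:C *: p; pose l := (1 + nrm q0)^-1.
have l0 : 0 < l by rewrite invr_gt0 ltr_wpDr ?nrm_ge0.
pose q := l%:C *: q0.
have hp : cs_comm h p by rewrite /cs_comm cs_mulA.
have hq : cs_comm h q by apply/cs_commZ/cs_commD; [exact: cs_commM|exact/cs_commN/cs_commZ].
have pq : cs_comm p q by apply/cs_commC/cs_commM; exact: cs_commC.
have sq : cs_star q = q.
  by rewrite /q cs_starZR cs_starD cs_starN cs_starZR cs_star_mul sp.
have q1 b : nrm (q ** b) <= nrm b.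
  apply: le_trans (nrm_mul _ _) _; rewrite ler_piMl ?nrm_ge0 //.
  rewrite nrmZR ?(ltW l0) // /l mulrC ler_pdivrMr ?ltr_wpDr ?nrm_ge0 //.
  by rewrite mul1r lerDr.
(* r stands for |q|, the root of q^2, and s below for the root of |q|. *)
have [|r [sr cr rr r1]] := sqrt_positive _ (sub_sqr_contraction sq q1).
  by rewrite cs_star_mul sq.
have rq : cs_comm r q by apply: cr; rewrite /cs_comm cs_mulA.
have rh : cs_comm r h by apply/cr/cs_commC/cs_commM.
have rp : cs_comm r p by exact: cs_commM.
have [s [ss cs sr2 _]] := sqrt_positive sr r1.
have sp' : cs_comm s p by exact: cs.
have sh' : cs_comm s h by exact: cs.
have sq' : cs_comm s q by exact: cs.
have sr' : cs_comm s r by exact: cs.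
have fg0 : f (q + r) = 0.
  (* Y = 1 - sqrt (1 - f p / c). Then b0 = f h (1 - Y) squares to f p - (f p)^2 / c and b squares to
     - f q: the bound on f p is used to write - f q as a square. *)
  have [||Y [sY cY YY]] := @sqrt_contraction _ B ((c^-1)%:C *: f p).
  - by rewrite cs_starZR (star_hom_sa hf sp).
  - move=> b; apply: le_trans (nrm_mul _ _) _; rewrite ler_piMl ?nrm_ge0 //.
    by rewrite nrmZR ?invr_ge0 ?(ltW c0) // mulrC ler_pdivrMr // mul1r.
  have cY' z : cs_comm p z -> cs_comm Y (f z).
    by move=> pz; apply/cY/cs_commC/cs_commZ/cs_commC/(star_hom_comm hf).
  have YH : cs_comm Y (f h) by exact/cY'/cs_commC.
  have YP : cs_comm Y (f p) by exact/cY'.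
  have YS : cs_comm Y (f s) by exact/cY'/cs_commC.
  have YG : cs_comm Y (f (q + r)).
    by rewrite (star_homD hf); apply: cs_commD; apply: cY' => //; exact/cs_commC.
  pose b0 := f h - f h ** Y; pose b := (Num.sqrt (l * c))%:C *: b0.
  have sb : cs_star b = b.
    rewrite /b cs_starZR cs_starD cs_starN cs_star_mul sY (star_hom_sa hf sh).
    by rewrite YH.
  have bb : b ** b = - f q.
    rewrite /b cs_mulZl cs_mulZr scalerA -rmorphM /= -expr2 sqr_sqrtr; last first.
      by rewrite mulr_ge0 // ltW.
    have -> : b0 ** b0 = f p - f p ** (Y + Y - Y ** Y).
      rewrite /b0 !cs_mulE -[f h ** Y ** f h]cs_mulA YH !cs_mulA.
      by rewrite -(star_homM hf) -/p; lmod.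
    rewrite YY addrK cs_mulZr /q (star_homZ hf) (star_homD hf) (star_homN hf) (star_homZ hf).
    rewrite (star_homM hf p p).
    have lc : (l * c)%:C * (c^-1)%:C = l%:C by rewrite -rmorphM /= mulfK ?gt_eqF.
    by rewrite scalerDr scalerN scalerA lc rmorphM /=; lmod.
  set G := f (q + r); have sG : cs_star G = G.
    by apply: (star_hom_sa hf); rewrite cs_starD sq sr.
  have gh : cs_comm h (q + r) by apply: cs_commD => //; exact: cs_commC.
  have gs : cs_comm s (q + r) by apply: cs_commD.
  have hG : cs_comm (f h) G by exact: star_hom_comm.
  have bG : cs_comm b G.
    apply/cs_commC/cs_commZ/cs_commD; first exact/cs_commC.
    by apply/cs_commN/cs_commM; exact/cs_commC.
  have sG' : cs_comm (f s) G by exact: star_hom_comm.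
  have bs : cs_comm (f s) b.
    have hs : cs_comm (f s) (f h) by exact: star_hom_comm.
    by apply/cs_commZ/cs_commD => //; apply/cs_commN/cs_commM.
  have sGs : cs_star (f s ** G) = f s ** G.
    by rewrite cs_star_mul sG (star_hom_sa hf ss) sG'.
  have sGb : cs_star (b ** G) = b ** G by rewrite cs_star_mul sG sb bG.
  (* Because r^2 = q^2. The squares of f s G and b G are f r G^2 and - f q G^2, so they add up to 0,
     and [pythagoras] with c = 0 kills f s G. *)
  have rqG : f r ** G = f q ** G.
    rewrite /G -!(star_homM hf); congr f.
    by rewrite !cs_mulDr rr rq addrC.
  have cmG : cs_comm (f s ** G) (b ** G).
    apply: cs_commM; apply/cs_commC/cs_commM => //; exact/cs_commC.
  have sum0 : (f s ** G) ** (f s ** G) + (b ** G) ** (b ** G) = (2 * 0)%:C *: (f s ** G).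
    rewrite mulr0 scale0r !cs_comm_sqr // bb -(star_homM hf s) sr2 !cs_mulA.
    by rewrite rqG !cs_mulNl subrr.
  have sG0 : f s ** G = 0.
    apply: nrm_eq0; apply/eqP; rewrite eq_le nrm_ge0 andbT.
    apply: nrm_le_mulr => // z.
    have [+ _] := pythagoras (lexx 0) sGs sGb cmG sum0 z.
    by rewrite scale0r subr0.
  have rG0 : f r ** G = 0 by rewrite -sr2 (star_homM hf) -cs_mulA sG0 cs_mul0r.
  apply: cs_star_mul_eq0.
  by rewrite sG {1}/G (star_homD hf) cs_mulDl -rqG rG0 addr0.
have /eqP := ker fg0; rewrite (star_homD hk) addrC addr_eq0 => /eqP kr.
(* Now - k q = k r = (k s)^2, so u^2 = c k p - (k p)^2: the relation of [pythagoras] with radius c /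
   2, whence |k p| <= c / 2 + c / 2. *)
pose u := (Num.sqrt l)^-1%:C *: k s.
have uu : u ** u = c%:C *: k p - k p ** k p.
  rewrite /u cs_mulZl cs_mulZr scalerA -rmorphM /= -invfM -expr2 sqr_sqrtr ?ltW //.
  rewrite -(star_homM hk) sr2 kr /q (star_homZ hk) scalerN scalerA -rmorphM /=.
  rewrite mulVf ?gt_eqF // scale1r /q0 (star_homD hk) (star_homN hk) (star_homZ hk).
  by rewrite (star_homM hk p); lmod.
apply: nrm_le_mulr => [|z]; first exact: ltW.
have c2 : 0 <= c / 2 by rewrite divr_ge0 // ltW.
have [||||+ _] := @pythagoras _ _ (k p) u (c / 2) c2 _ _ _ _ z.
- exact: (star_hom_sa hk).
- by rewrite /u cs_starZR (star_hom_sa hk ss).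
- by apply/cs_commZ/cs_commC/(star_hom_comm hk).
- by rewrite uu addrC subrK mulrC divfK.
move=> e; rewrite -[k p ** z](subrK ((c / 2)%:C *: z)).
apply: le_trans (nrmD _ _) _; rewrite nrmZR //.
by have := nrm_ge0 z; nra.
Qed.

Lemma ker_nrm (a : A) : nrm (k a) <= nrm (f a).
Proof.
have sa (h : A) : cs_star h = h -> nrm (k h) <= nrm (f h).
  move=> sh; rewrite -(@ler_pXn2r _ 2) ?nnegrE ?nrm_ge0 //.
  have sq (D : cstarAlg R) (g : A -> D) : is_star_hom g ->
      nrm (g h) ^+ 2 = nrm (g (h ** h)).
    by move=> hg; rewrite -nrm_star_mul (star_hom_sa hg sh) (star_homM hg).
  (* [ker_nrm_sqr] asks for c > 0, while f (h^2) may vanish. *)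
  rewrite (sq _ k) // (sq _ f) //; apply/ler_addgt0Pr => e e0.
  apply: ker_nrm_sqr => //; first by rewrite ltr_wpDl ?nrm_ge0.
  by rewrite lerDl ltW.
rewrite -(@ler_pXn2r _ 2) ?nnegrE ?nrm_ge0 //.
rewrite -!nrm_star_mul -(star_hom_star hk) -(star_hom_star hf).
rewrite -(star_homM hk) -(star_homM hf); apply: sa.
by rewrite cs_star_mul cs_starK.
Qed.
End KernelDomination.

Lemma star_hom_id (R : realType) (A : cstarAlg R) : is_star_hom (@id A).
Proof. by split. Qed.

Lemma star_hom_nrm (R : realType) (A B : cstarAlg R) (f : A -> B) :
  is_star_hom f -> forall a, nrm (f a) <= nrm a.
Proof. by move=> hf; apply: (ker_nrm (star_hom_id A) hf) => a ->; exact: star_hom0. Qed.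

Lemma star_hom_cvg (R : realType) (A B : cstarAlg R) (f : A -> B)
    (T : Type) (F : set_system T) {FF : Filter F} (u : T -> A) (l : A) :
  is_star_hom f -> u @ F --> l -> f (u t) @[t --> F] --> f l.
Proof.
move=> hf /cvg_nrmP h; apply/cvg_nrmP => e /h; apply: filterS => t.
rewrite -(star_homN hf) -(star_homD hf); apply: le_lt_trans.
exact: star_hom_nrm.
Qed.

Lemma star_hom_eq_closed (R : realType) (A B : cstarAlg R) (f g : A -> B) :
  is_star_hom f -> is_star_hom g -> is_cstar_subalg [set x | f x = g x].
Proof.
move=> hf hg; split => /=.
- by rewrite (star_hom0 hf) (star_hom0 hg).
- move=> c x y; rewrite (star_homD hf) (star_homD hg) (star_homZ hf) (star_homZ hg).
  by move=> -> ->.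
- by move=> x y ex ey; rewrite (star_homM hf) (star_homM hg) ex ey.
- by move=> x ex; rewrite (star_hom_star hf) (star_hom_star hg) ex.
rewrite (_ : [set x | _] = (fun x => f x - g x) @^-1` [set 0]); last first.
  apply/seteqP; split => x /=; first by move=> ->; rewrite subrr.
  by move/eqP; rewrite subr_eq0 => /eqP.
apply: preimage_closed; last first.
  by apply: (@accessible_closed_set1 B); apply/hausdorff_accessible/norm_hausdorff.
move=> x _; apply: cvgB; apply: star_hom_cvg => //.
Qed.

Lemma star_hom_comp (R : realType) (A B C : cstarAlg R) (f : A -> B) (g : B -> C) :
  is_star_hom f -> is_star_hom g -> is_star_hom (g \o f).
Proof.
move=> hf hg; split=> [c x y|x y|x] /=.
- by rewrite !(star_hom_linear hf, star_hom_linear hg).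
- by rewrite (star_homM hf) (star_homM hg).
- by rewrite (star_hom_star hf) (star_hom_star hg).
Qed.

(** * Resolvents and self-adjointness of closed ideals *)

Section Resolvent.
Variables (R : realType) (A : cstarAlg R) (x : A) (e : R).
Hypotheses (e0 : 0 < e) (sx : cs_star x = x).
Hypothesis x1 : forall b, nrm (b - x ** b) <= nrm b.

Let t : R := (1 + e)^-1.
Let t0 : 0 < t. Proof. by rewrite invr_gt0 ltr_wpDl. Qed.
Let t1 : t < 1. Proof. by rewrite invf_lt1 ?ltrDl // ltr_wpDl. Qed.

(** The equation x p + e p = x, that is p = x (x + e)^-1, reads (1 + e) p = x + (p - x p). As 1 - x
    does not increase norms, F contracts by t = 1 / (1 + e). Its iterates stay in every subspace
    that contains x and is stable under left multiplication by x, in particular in an ideal. *)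
Let F (y : A) := t%:C *: (x + (y - x ** y)).
Let u n := iter n F 0.

Let F_lip y z : nrm (F y - F z) <= t * nrm (y - z).
Proof.
have -> : F y - F z = t%:C *: ((y - z) - x ** (y - z)).
  by rewrite /F cs_mulDr cs_mulNr; lmod.
by rewrite nrmZR ?(ltW t0) // ler_pM2l.
Qed.

Let u_bound n : nrm (u n) <= nrm x / (1 - t).
Proof.
have t1' : 0 < 1 - t by rewrite subr_gt0.
rewrite ler_pdivlMr //.
elim: n => [|n ih]; first by rewrite nrm0 mul0r nrm_ge0.
have h : nrm (u n.+1) <= t * (nrm x + nrm (u n)).
  rewrite /= nrmZR ?(ltW t0) // ler_pM2l //.
  by apply: le_trans (nrmD _ _) _; rewrite lerD2l.
apply: le_trans (ler_wpM2r (ltW t1') h) _.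
have := ler_wpM2l (ltW t0) ih.
have := mulr_ge0 (nrm_ge0 x) (sqr_ge0 (1 - t)).
by move: (nrm x) (nrm (u n)) => X U; nra.
Qed.

Let u_dist n p : (n <= p)%N -> nrm (u p - u n) <= t ^+ n * (nrm x / (1 - t)).
Proof.
elim: n p => [|n ih] p; first by rewrite subr0 mul1r.
case: p => // p; rewrite ltnS => /ih h.
apply: le_trans (F_lip _ _) _.
by rewrite exprS -mulrA ler_pM2l.
Qed.

Lemma resolvent_exists (S : set A) : closed S -> S 0 ->
  (forall (c : R[i]) y z, S y -> S z -> S (c *: y + z)) -> S x ->
  (forall y, S y -> S (x ** y)) ->
  exists p, [/\ S p, cs_star p = p, forall w, cs_comm x w -> cs_comm p w &
    x ** p + e%:C *: p = x].
Proof.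
move=> cS S0 SD Sx SM.
have [|p up] := nrm_cauchy_cvg u_dist.
  have -> : 0 = 0 * (nrm x / (1 - t)) :> R by rewrite mul0r.
  apply: cvgM; last exact: cvg_cst.
  by apply: cvg_expr; rewrite ger0_norm // ltW.
have uSx n : cs_comm (u n) x.
  elim: n => [|n ih]; first by rewrite /cs_comm cs_mul0l cs_mul0r.
  apply/cs_commC/cs_commZ/cs_commD => //; apply/cs_commD; first exact: cs_commC.
  by apply/cs_commN/cs_commM => //; apply/cs_commC.
have upS : u n.+1 @[n --> \oo] --> p by rewrite cvg_shiftS.
have e1 : 1 + e != 0 by rewrite gt_eqF // ltr_wpDl.
exists p; split.
- have h : \forall n \near \oo, S (u n).
    have SA y z : S y -> S z -> S (y + z) by rewrite -{2}[y]scale1r; exact: SD.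
    have SZ (c : R[i]) y : S y -> S (c *: y).
      by move=> Sy; rewrite -[_ *: _]addr0; exact: SD.
    apply: nearW; elim=> [//|n ih]; apply/SZ/SA => //; apply: SA => //.
    by rewrite -scaleN1r; exact/SZ/SM.
  exact: (closed_cvg _ cS h _ up).
- apply/esym/(cvg_normed_unique up).
  rewrite (_ : u = fun n => cs_star (u n)); first exact: cvg_cs_star.
  apply/funext => n; elim: n => [|n ih]; first by rewrite cs_star0.
  by rewrite /= /F cs_starZR !cs_starD cs_starN cs_star_mul sx -ih uSx.
- move=> w xw; have l1 : u n ** w @[n --> \oo] --> p ** w.
    by apply: cvg_cs_mul => //; exact: cvg_cst.
  apply: (cvg_normed_unique l1).
  rewrite (_ : (fun n => _) = fun n => w ** u n).
    by apply: cvg_cs_mul => //; exact: cvg_cst.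
  apply/funext => n; elim: n => [|n ih]; first by rewrite cs_mul0l cs_mul0r.
  apply/cs_commC/cs_commZ/cs_commD; first exact/cs_commC.
  apply: cs_commD; first exact/cs_commC.
  by apply/cs_commN/cs_commM; exact/cs_commC.
- have l1 : F (u n) @[n --> \oo] --> F p.
    apply: cvgZ; first exact: cvg_cst.
    apply: cvgD; first exact: cvg_cst.
    apply: cvgB => //; apply: cvg_cs_mul => //; exact: cvg_cst.
  have pE : (1 + e)%:C *: p = x + (p - x ** p).
    rewrite {1}(cvg_normed_unique upS l1) scalerA -rmorphM /=.
    by rewrite divff // scale1r.
  apply: (addrI (p - x ** p)); rewrite [RHS]addrC -pE rmorphD /=.
  by lmod.
Qed.
End Resolvent.

Definition end_alg (R : realType) (T : cprecat R) (n : nat) : cstarAlg R :=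
  @CstarAlg R (T n n) (@comp R T n n n) (@star R T n n)
    (fun y => comp_linearl y) (fun y => comp_linearr y) (@compA R T n n n n)
    (@star_antilinear R T n n) (@starK R T n n) (@star_comp R T n n n)
    (@norm_comp R T n n n) (@norm_star_comp R T n n).

Section Precat.
Variables (R : realType) (T : cprecat R).

Lemma compDl n m l (a a' : T n m) (b : T m l) :
  comp (a + a') b = comp a b + comp a' b.
Proof. exact: (linear_D (comp_linearl b)). Qed.
Lemma compDr n m l (a : T n m) (b b' : T m l) :
  comp a (b + b') = comp a b + comp a b'.
Proof. exact: (linear_D (comp_linearr a)). Qed.
Lemma compNl n m l (a : T n m) (b : T m l) : comp (- a) b = - comp a b.
Proof. exact: (linear_N (comp_linearl b)). Qed.
Lemma compNr n m l (a : T n m) (b : T m l) : comp a (- b) = - comp a b.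
Proof. exact: (linear_N (comp_linearr a)). Qed.
Lemma comp0l n m l (b : T m l) : comp (0 : T n m) b = 0.
Proof. exact: (linear_0 (comp_linearl b)). Qed.
Lemma comp0r n m l (a : T n m) : comp a (0 : T m l) = 0.
Proof. exact: (linear_0 (comp_linearr a)). Qed.

Lemma starD n m (a b : T n m) : star (a + b) = star a + star b.
Proof. by have := star_antilinear 1 a b; rewrite conjC1 !scale1r. Qed.
Lemma star0 n m : star (0 : T n m) = 0.
Proof. by apply: (addrI (star (0 : T n m))); rewrite -starD !addr0. Qed.
Lemma starZ n m (c : R[i]) (a : T n m) : star (c *: a) = Num.conj c *: star a.
Proof. by have := star_antilinear c a 0; rewrite star0 !addr0. Qed.
Lemma starN n m (a : T n m) : star (- a) = - star a.
Proof. by rewrite -scaleN1r starZ rmorphN1 scaleN1r. Qed.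

Lemma nrm_star_comp n m (a : T n m) : nrm (comp (star a) a) = nrm a ^+ 2.
Proof. by apply: complexI; rewrite rmorphXn /= -!normE norm_star_comp. Qed.

Lemma nrm_comp n m l (a : T n m) (b : T m l) : nrm (comp a b) <= nrm a * nrm b.
Proof. by rewrite -lecR rmorphM /= -!normE norm_comp. Qed.
End Precat.

Section IdealStar.
Variables (R : realType) (T : rtcat R) (K : homsets T).
Arguments K : clear implicits.
Hypothesis iK : is_ideal K.

Lemma idealZ n m (c : R[i]) (a : T n m) : K n m a -> K n m (c *: a).
Proof. by move=> Ka; rewrite -[_ *: _]addr0; apply: idealD => //; exact: ideal0. Qed.

Lemma idealDD n m (a b : T n m) : K n m a -> K n m b -> K n m (a + b).
Proof. by move=> Ka Kb; rewrite -[a]scale1r; exact: idealD. Qed.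

(* For h = a a^* with |a| <= 1, the elements p = h^2 (h^2 + e^2)^-1 of K are
   an approximate unit for a^*: the pair p, q = e h (h^2 + e^2)^-1 satisfies
   p^2 + q^2 = p. *)
Lemma ideal_star n m (a : T n m) : K n m a -> K m n (star a).
Proof.
wlog a1 : a / nrm a <= 1.
  move=> wl Ka; pose l := (1 + nrm a)^-1.
  have l0 : 0 < l by rewrite invr_gt0 ltr_wpDr ?nrm_ge0.
  have -> : star a = (l^-1)%:C *: star (l%:C *: a).
    by rewrite starZ scalCR_conj scalerA -rmorphM /= mulVf ?gt_eqF // scale1r.
  apply/idealZ/wl; last exact: idealZ.
  rewrite nrmZR ?(ltW l0) // /l mulrC ler_pdivrMr ?ltr_wpDr ?nrm_ge0 //.
  by rewrite mul1r lerDr.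
move=> Ka; pose h : end_alg T n := comp a (star a).
have Kh : K n n h by exact: ideal_compr.
have sh : cs_star h = h by rewrite /= star_comp starK.
have h1 b : nrm (h ** b) <= nrm b.
  apply: le_trans (nrm_mul _ _) _; rewrite ler_piMl ?nrm_ge0 //.
  apply: le_trans (nrm_comp _ _) _.
  have -> : nrm (star a) = nrm a.
    have le k l (y : T k l) : nrm y <= nrm (star y).
      have := nrm_comp (star y) y; rewrite nrm_star_comp.
      have := nrm_ge0 y; rewrite le_eqVlt => /orP[/eqP <- _|y0]; first exact: nrm_ge0.
      by rewrite expr2 ler_pM2r.
    by apply/eqP; rewrite eq_le le -{2}(starK a) le.
  by rewrite mulr_ile1 ?nrm_ge0.
have x1 := sub_sqr_contraction sh h1.
have sx : cs_star (h ** h) = h ** h by rewrite cs_star_mul sh.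
apply: closed_nrmP; first exact: ideal_closed.
(* The final estimate is |a^* - a^* p|^2 <= e < 2 e = d^2. *)
move=> d d0; pose e := d ^+ 2 / 2; have e0 : 0 < e by rewrite divr_gt0 ?exprn_gt0.
have [|||||p [Kp sp cp pE]] :=
  @resolvent_exists _ _ (h ** h) (e * e) (mulr_gt0 e0 e0) sx x1 (K n n).
- exact: ideal_closed.
- exact: ideal0.
- exact: idealD.
- exact: (@ideal_compl _ _ _ iK n n n h h Kh).
- by move=> y Ky; exact: (@ideal_compl _ _ _ iK n n n (h ** h) y Ky).
have ph : cs_comm p h by apply: cp; rewrite /cs_comm cs_mulA.
pose q : end_alg T n := (e^-1)%:C *: (h - h ** p).
have sq : cs_star q = q by rewrite /q cs_starZR cs_starD cs_starN cs_star_mul sp sh ph.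
have pq : cs_comm p q by apply/cs_commZ/cs_commD => //; apply/cs_commN/cs_commM.
have ee : (e^-1)%:C * (e^-1)%:C * (e * e)%:C = 1 :> R[i].
  by rewrite -!rmorphM /= mulrACA mulVf ?gt_eqF // mulr1.
have hhE : h ** h - h ** h ** p = (e * e)%:C *: p by rewrite -{1}pE addrAC subrr add0r.
have qq : q ** q = p - p ** p.
  rewrite /q cs_mulZl cs_mulZr scalerA.
  have -> : (h - h ** p) ** (h - h ** p) = (e * e)%:C *: (p - p ** p).
    rewrite scalerBr -cs_mulZl -hhE !cs_mulE -[h ** p ** h]cs_mulA ph !cs_mulA.
    by lmod.
  by rewrite scalerA ee scale1r.
have half0 : 0 <= 2^-1 :> R by rewrite invr_ge0.
have pyth b := @pythagoras _ _ p q 2^-1 half0 sp sq pq _ b.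
have {}pyth b : nrm (p ** b - (2^-1)%:C *: b) <= 2^-1 * nrm b /\ nrm (q ** b) <= 2^-1 * nrm b.
  by apply: pyth; rewrite qq addrC subrK divff // scale1r.
have p1 : nrm p <= 1.
  apply: nrm_le_mulr => // b; have [+ _] := pyth b.
  rewrite -{2}[p ** b](subrK ((2^-1)%:C *: b)) => hp.
  by apply: le_trans (nrmD _ _) _; rewrite nrmZR //; lra.
have q1 : nrm q <= 2^-1 by apply: nrm_le_mulr => // b; case: (pyth b).
exists (comp (star a) p); first exact: ideal_compl.
rewrite -(@ltr_pXn2r _ 2) ?nnegrE ?nrm_ge0 ?(ltW d0) // -nrm_star_comp.
set w := comp _ _.
(* w is (1 - p) h (1 - p), and e q = h - h p; the bounds |p| <= 1 and |q| <= 1/2 then give |w| <=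
   e. *)
have -> : w = (e%:C *: (q - p ** q) : T n n).
  rewrite /w starD starN star_comp starK.
  rewrite -[star p]/(cs_star p) sp /q.
  have -> : (e%:C *: ((e^-1)%:C *: (h - h ** p) - p ** ((e^-1)%:C *: (h - h ** p))) : T n n)
      = (h - h ** p) - p ** (h - h ** p).
    rewrite cs_mulZr -scalerBr scalerA -rmorphM /= divff ?gt_eqF // scale1r //.
  rewrite !(compDl, compDr, compNl, compNr) cs_mulE /= /h compNr !compA.
  by lmod.
rewrite nrmZR ?(ltW e0) //.
have : nrm (q - p ** q) <= 1.
  apply: le_trans (nrmB _ _) _.
  have := nrm_mul p q; have := ler_pM (nrm_ge0 _) (nrm_ge0 _) p1 q1.
  by move: q1 => /=; lra.
have -> : d ^+ 2 = 2 * e by rewrite /e mulrC divfK.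
by move: e0; nra.
Qed.
End IdealStar.

(** * The algebra DR(T) *)

Section Tensk.
Variables (R : realType) (T : rtcat R).

Lemma tensk_comp k n m l (a : T n m) (b : T m l) :
  tensk k (comp a b) = comp (tensk k a) (tensk k b).
Proof. by elim: k => //= k ->; rewrite tens1_comp. Qed.

Lemma tensk_star k n m (a : T n m) : tensk k (star a) = star (tensk k a).
Proof. by elim: k => //= k ->; rewrite tens1_star. Qed.
End Tensk.

Lemma fsumT_seq (V : nmodType) (I : choiceType) (r : seq I) (F : I -> V) :
  uniq r -> (forall i, i \notin r -> F i = 0) ->
  \sum_(i \in [set: I]) F i = \sum_(i <- r) F i.
Proof.
move=> ur F0; rewrite [RHS]fsbig_seq //; apply/esym/fsbig_widen => // i [_ /= ir].
by apply: F0; apply/negP.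
Qed.

Section DRComponents.
Variables (R : realType) (T : rtcat R) (D : DR_model T).
Let g := dr_gr D.

Lemma dr_emb_inj1 k (x : g k) : dr_emb x = 0 -> x = 0.
Proof.
move=> x0; pose f j : g j := match @eqP _ k j with
  | ReflectT e => ecast i (g i) e x | _ => 0 end.
have fk : f k = x by rewrite /f; case: eqP => // e; rewrite eq_axiomK.
have fN j : k != j -> f j = 0 by rewrite /f; case: eqP => // ->; rewrite eqxx.
have fs : fin_supp f.
  apply: (@sub_finite_set _ _ [set k]) => // j /=.
  by apply: contraNP => jk; rewrite fN //; apply/eqP => kj; exact: jk.
rewrite -fk; apply: dr_emb_inj => //; rewrite /dsum (@fsumT_seq _ _ [:: k]) //.
  by rewrite big_seq1 fk.
move=> j; rewrite inE eq_sym => /fN ->; exact: (linear_0 (@dr_emb_linear _ _ D j)).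
Qed.

Let I0 := dr_indlim g 0.

(** Well typed because 0 + 0, and - 0 in [dr_star0], compute to 0 in [int]. *)
Definition dr_mul0 (x y : g 0) : g 0 := dr_mul x y.
Definition dr_star0 (x : g 0) : g 0 := dr_star x.

Lemma dr_emb_mul0 x y : dr_emb (dr_mul0 x y) = dr_emb x ** dr_emb y.
Proof. exact: (dr_emb_mul x y). Qed.
Lemma dr_emb_star0 x : dr_emb (dr_star0 x) = cs_star (dr_emb x).
Proof. exact: (dr_emb_star x). Qed.

Lemma dr_emb_injective k : injective (@dr_emb _ _ D k).
Proof.
move=> x y xy; apply/eqP; rewrite -subr_eq0; apply/eqP/dr_emb_inj1.
by rewrite (linear_B (@dr_emb_linear _ _ D k)) xy subrr.
Qed.

Let nrm_dr_mul0 (x y : g 0) : nrm (dr_mul0 x y) <= nrm x * nrm y.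
Proof. by rewrite -lecR rmorphM /= -!normE; exact: (dr_norm_mul x y). Qed.

Let nrm_dr_star0 (x : g 0) : nrm (dr_star0 x) = nrm x.
Proof. by rewrite /nrm; congr complex.Re; exact: (dr_norm_star x). Qed.

(** The norm of [dr_in] is the limit of the norms |a (x) 1^s|, and each of them obeys the
    C*-identity of T. *)
Let nrm_dr_in0 n (a : T n n) :
  nrm (dr_mul0 (dr_star0 (dr_in g 0 a)) (dr_in g 0 a)) = nrm (dr_in g 0 a) ^+ 2.
Proof.
have nn : n%:Z = n%:Z + 0 by rewrite addr0.
have -> : dr_mul0 (dr_star0 (dr_in g 0 a)) (dr_in g 0 a) = dr_in g 0 (comp (star a) a).
  have nn' : n%:Z = n%:Z + - 0 by rewrite oppr0 addr0.
  rewrite /dr_star0 (dr_star_in g a nn).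
  exact: (@dr_mul_in R T g (- (0 : int)) 0 _ _ _ (star a) a nn' nn).
have l1 := indlim_norm I0 (a := comp (star a) a) nn.
have l2 := indlim_norm I0 (a := a) nn.
apply: (cvg_unique (@norm_hausdorff _ _) l1).
rewrite expr2; have -> : (fun s => nrm (tensk s (comp (star a) a))) =
    (fun s => nrm (tensk s a) * nrm (tensk s a)).
  by apply/funext => s; rewrite tensk_comp tensk_star nrm_star_comp expr2.
exact: cvgM.
Qed.

Let dr_starB (x y : g 0) : dr_star0 (x - y) = dr_star0 x - dr_star0 y.
Proof.
have h := dr_star_antilinear (-1) y x.
rewrite rmorphN1 !scaleN1r in h.
by rewrite addrC [RHS]addrC; exact: h.
Qed.

Let dr_mul0Br (x y z : g 0) : dr_mul0 z (x - y) = dr_mul0 z x - dr_mul0 z y.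
Proof. exact: (linear_B (@dr_mul_linearr _ _ g 0 0 z) x y). Qed.

Let dr_mul0Bl (x y z : g 0) : dr_mul0 (x - y) z = dr_mul0 x z - dr_mul0 y z.
Proof. exact: (linear_B (@dr_mul_linearl _ _ g 0 0 z) x y). Qed.

(** The nontrivial inequality passes by density from the images y of the T(n,n), both sides being
    continuous. *)
Let nrm_dr_star_mul0 (x : g 0) : nrm (dr_mul0 (dr_star0 x) x) = nrm x ^+ 2.
Proof.
apply/eqP; rewrite eq_le; apply/andP; split.
  by apply: le_trans (nrm_dr_mul0 _ _) _; rewrite nrm_dr_star0 expr2.
apply/ler_addgt0Pr => d d0; have x0 := nrm_ge0 x.
(* Replacing x by y costs e (|x| + |y|) on either side, and |y| <= |x| + 1 bounds the total by 2 e
   (2 |x| + 1) <= d. *)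
pose e := Num.min 1 (d / (2 * (2 * nrm x + 1))).
have k0 : 0 < 2 * (2 * nrm x + 1) by rewrite mulr_gt0 // ltr_wpDl // mulr_ge0.
have e0 : 0 < e by rewrite lt_min ltr01 divr_gt0.
have e1 : e <= 1 by rewrite ge_min lexx.
have ed : e * (2 * (2 * nrm x + 1)) <= d by rewrite -ler_pdivlMr // ge_min lexx orbT.
have [_ [n [m [a [nm ->]]]] xy] := dense_nrmP (indlim_dense I0) x e0.
move: nm; rewrite addr0 => -[nm]; subst m.
set y := dr_in _ _ a in xy *; have hy := nrm_dr_in0 a; rewrite -/y in hy.
have yx : nrm y <= nrm x + e.
  by rewrite -{1}[y](subrK x) addrC; apply: le_trans (nrmD _ _) _; rewrite lerD2l nrm_distC ltW.
have xy' : nrm x <= nrm y + e.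
  by rewrite -{1}[x](subrK y) addrC; apply: le_trans (nrmD _ _) _; rewrite lerD2l ltW.
have B : dr_mul0 (dr_star0 y) y =
  dr_mul0 (dr_star0 x) x - (dr_mul0 (dr_star0 x) (x - y) + dr_mul0 (dr_star0 (x - y)) y).
  rewrite dr_mul0Br dr_starB dr_mul0Bl.
  by rewrite subrKA opprB addrC subrK.
have : nrm y ^+ 2 <= nrm (dr_mul0 (dr_star0 x) x) + (nrm x * e + e * nrm y).
  rewrite -hy B; apply: le_trans (nrmB _ _) _; rewrite lerD2l.
  apply: le_trans (nrmD _ _) _; apply: lerD.
    apply: le_trans (nrm_dr_mul0 _ _) _; rewrite nrm_dr_star0.
    by rewrite ler_wpM2l // ltW.
  apply: le_trans (nrm_dr_mul0 _ _) _; rewrite nrm_dr_star0.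
  by rewrite ler_wpM2r ?nrm_ge0 // ltW.
have y0 := nrm_ge0 y.
have h1 : nrm x ^+ 2 <= nrm y ^+ 2 + e * (nrm x + nrm y).
  have [xe|ex] := leP (nrm x) (nrm y).
    have : nrm x ^+ 2 <= nrm y ^+ 2 by rewrite ler_pXn2r.
    move/le_trans; apply; rewrite lerDl mulr_ge0 ?addr_ge0 //.
    exact: ltW.
  by move: xy' x0 y0 e0; nra.
have h2 : e * nrm y <= e * (nrm x + 1) by rewrite ler_pM2l //; lra.
by move: ed h1 h2; nra.
Qed.

(** The algebraic laws of degree 0 are pulled back from D along the injective [dr_emb]; only the
    C*-identity needs an argument inside [g 0]. *)
Lemma dr_mul0A : associative dr_mul0.
Proof. by move=> x y z; apply: dr_emb_injective; rewrite !dr_emb_mul0 cs_mulA. Qed.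

Lemma dr_star0K : involutive dr_star0.
Proof. by move=> x; apply: dr_emb_injective; rewrite !dr_emb_star0 cs_starK. Qed.

Lemma dr_star0M x y : dr_star0 (dr_mul0 x y) = dr_mul0 (dr_star0 y) (dr_star0 x).
Proof.
by apply: dr_emb_injective; rewrite !(dr_emb_star0, dr_emb_mul0) cs_star_mul.
Qed.

Fact dr_norm_star_mul0 x : `|dr_mul0 (dr_star0 x) x| = `|x| ^+ 2.
Proof. by rewrite !normE nrm_dr_star_mul0 rmorphXn. Qed.

Definition dr_zero_alg : cstarAlg R :=
  @CstarAlg R (g 0) dr_mul0 dr_star0
    (@dr_mul_linearl _ _ g 0 0) (@dr_mul_linearr _ _ g 0 0) dr_mul0A
    (@dr_star_antilinear _ _ g 0) dr_star0K dr_star0M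
    (@dr_norm_mul _ _ g 0 0) dr_norm_star_mul0.

(** In degree 0, [dr_emb] is a *-homomorphism between C*-algebras. In degree k, the C*-identity of D
    reduces to x^* x in degree 0. The bound carries approximations in the inductive limits over to
    D. *)
Lemma dr_emb_nrm k (x : g k) : nrm (dr_emb x) <= nrm x.
Proof.
have h0 (y : g 0) : nrm (dr_emb y) <= nrm y.
  apply: (@star_hom_nrm R dr_zero_alg D (@dr_emb _ _ D 0)); split.
  - exact: dr_emb_linear.
  - exact: dr_emb_mul0.
  - exact: dr_emb_star0.
(* The degree - k + k is 0 only up to a provable equality. *)
have h j (y : g j) : j = 0 -> nrm (dr_emb y) <= nrm y by move=> j0; subst j.
rewrite -(@ler_pXn2r _ 2) ?nnegrE ?nrm_ge0 // -nrm_star_mul -dr_emb_star -dr_emb_mul.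
apply: le_trans (h _ _ _) _; first by rewrite addNr.
rewrite -lecR rmorphXn /= -!normE expr2; apply: le_trans (dr_norm_mul _ _) _.
by rewrite dr_norm_star.
Qed.
End DRComponents.

(** * Families compatible with (x) 1 and their graphs *)

Record is_tens_rep (R : realType) (T : rtcat R) (B : cstarAlg R)
    (pi : forall n m, T n m -> B) : Prop := {
  tr_linear : forall n m, linear (pi n m);
  tr_star : forall n m (a : T n m), cs_star (pi n m a) = pi m n (star a);
  tr_mul : forall n m l (a : T n m) (b : T m l),
    pi n m a ** pi m l b = pi n l (comp a b);
  tr_tens1 : forall n m (a : T n m), pi n.+1 m.+1 (tens1 a) = pi n m a }.

Section TensRep.
Variables (R : realType) (T : rtcat R) (B : cstarAlg R).
Variable pi : forall n m, T n m -> B.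

Lemma tr_tensk : is_tens_rep pi ->
  forall k n m (a : T n m), pi (tensk k a) = pi a.
Proof. by move=> h; elim=> //= k ih n m a; rewrite (tr_tens1 h). Qed.

(** With [rt_rep_tens_rep], these families are exactly the coisometric representations of T: the
    product rule at k = 0 is multiplicativity, and invariance under (x) 1 restores it for every
    k. *)
Lemma tens_rep_rt_rep : is_tens_rep pi ->
  is_rt_rep (full T) pi /\ coisometric (full T) pi.
Proof.
move=> h; split; last by move=> n m a _; rewrite (tr_tens1 h).
split=> [n m c a b _ _|n m a _|n m k l a b _ _].
- exact: (tr_linear h).
- exact: (tr_star h).
- by rewrite -(tr_mul h) (tr_tensk h).
Qed.

Lemma rt_rep_tens_rep : is_rt_rep (full T) pi -> coisometric (full T) pi ->
  is_tens_rep pi.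
Proof.
move=> h c; split=> [n m k a b|n m a|n m l a b|n m a].
- exact: (rep_linear h).
- exact: (rep_star h).
- exact: (@rep_mul _ _ _ _ _ h n m 0 l a b).
- by rewrite -(c n m a).
Qed.

Lemma tens_rep_end_hom n : is_tens_rep pi ->
  @is_star_hom R (end_alg T n) B (@pi n n).
Proof.
move=> h; split=> [|a b|a]; first exact: (tr_linear h).
  by rewrite (tr_mul h).
by rewrite (tr_star h).
Qed.
End TensRep.

Section DRCan.
Variables (R : realType) (T : rtcat R) (D : DR_model T).
Local Notation g := (dr_gr D).

Lemma dr_canE k n m (a : T n m) : n%:Z = m%:Z + k ->
  dr_can D a = dr_emb (dr_in g k a).
Proof. by move=> e; have -> : k = n%:Z - m%:Z by rewrite e addrC addKr. Qed.

Let subrKC' (n m : nat) : n%:Z = m%:Z + (n%:Z - m%:Z).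
Proof. lia. Qed.

Lemma dr_can_rep : is_tens_rep (dr_can D).
Proof.
split=> [n m c a b|n m a|n m l a b|n m a].
- rewrite /dr_can (indlim_linear (dr_indlim g (n%:Z - m%:Z))) //.
  exact: dr_emb_linear.
- rewrite (dr_canE (k := - (n%:Z - m%:Z)) (star a)); last lia.
  by rewrite -(dr_star_in g a (subrKC' n m)) dr_emb_star.
- rewrite (dr_canE (k := (n%:Z - m%:Z) + (m%:Z - l%:Z)) (comp a b)); last lia.
  by rewrite -(dr_mul_in g a b (subrKC' n m) (subrKC' m l)) dr_emb_mul.
- rewrite (dr_canE (k := n%:Z - m%:Z) (tens1 a)); last lia.
  by rewrite (indlim_tens1 (dr_indlim g _)).
Qed.
End DRCan.

Section Extension.
Variables (R : realType) (T : rtcat R) (D : DR_model T) (B : cstarAlg R).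
Variable pi : forall n m, T n m -> B.
Hypothesis hpi : is_tens_rep pi.
Local Notation g := (dr_gr D).
Let hcan := dr_can_rep D.

(** The extension is built as a relation, since independence of the representative a is only a
    consequence of the norm bound. *)
Definition hpair (k : int) (x : D) (y : B) : Prop :=
  exists n m (a : T n m), [/\ n%:Z = m%:Z + k, x = dr_can D a & y = pi a].

Lemma hpair0 k : hpair k 0 0.
Proof.
have c0 n m : dr_can D (0 : T n m) = 0 by exact: (linear_0 (@tr_linear _ _ _ _ hcan n m)).
have p0 n m : pi (0 : T n m) = 0 by exact: (linear_0 (@tr_linear _ _ _ _ hpi n m)).
case: k => k; [exists k, 0, 0|exists 0, k.+1, 0]; split; rewrite ?c0 ?p0 ?add0r //.
by rewrite NegzE subrr.
Qed.

Lemma hpairD k x y x' y' (c : R[i]) :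
  hpair k x y -> hpair k x' y' -> hpair k (c *: x + x') (c *: y + y').
Proof.
move=> [n [m [a [e -> ->]]]] [n' [m' [a' [e' -> ->]]]].
have [mm|mm] := leqP m m'.
  (* The representative of lower level is tensored up to the other; the indices take the form s + m
     and s + n in which [tensk] lands. *)
  have em : m' = ((m' - m) + m)%N by rewrite subnK.
  have en : n' = ((m' - m) + n)%N by lia.
  move: (m' - m)%N em en a' e' => s em en; subst m' n' => a' e'.
  exists (s + n)%N, (s + m)%N, (c *: tensk s a + a'); split=> //.
    by rewrite (tr_linear hcan) (tr_tensk hcan).
  by rewrite (tr_linear hpi) (tr_tensk hpi).
have em : m = ((m - m') + m')%N by rewrite subnK // ltnW.
have en : n = ((m - m') + n')%N by lia.
move: (m - m')%N em en a e mm => s em en; subst m n => a e _.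
exists (s + n')%N, (s + m')%N, (c *: a + tensk s a'); split=> //.
  by rewrite (tr_linear hcan) (tr_tensk hcan).
by rewrite (tr_linear hpi) (tr_tensk hpi).
Qed.

Lemma hpairM j k x y x' y' :
  hpair j x y -> hpair k x' y' -> hpair (j + k) (x ** x') (y ** y').
Proof.
move=> [n [m [a [e -> ->]]]] [n' [m' [a' [e' -> ->]]]].
have [mm|mm] := leqP m n'.
  have em : n' = ((n' - m) + m)%N by rewrite subnK.
  move: (n' - m)%N em a' e' mm => s em; subst n' => a' e' _.
  exists (s + n)%N, m', (comp (tensk s a) a'); split.
  - by move: e e'; rewrite !PoszD; lia.
  - by rewrite -(tr_mul hcan) (tr_tensk hcan).
  - by rewrite -(tr_mul hpi) (tr_tensk hpi).
have em : m = ((m - n') + n')%N by rewrite subnK // ltnW.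
move: (m - n')%N em a e mm => s em; subst m => a e _.
exists n, (s + m')%N, (comp a (tensk s a')); split.
- by move: e e'; rewrite !PoszD; lia.
- by rewrite -(tr_mul hcan) (tr_tensk hcan).
- by rewrite -(tr_mul hpi) (tr_tensk hpi).
Qed.

Lemma hpair_star k x y : hpair k x y -> hpair (- k) (cs_star x) (cs_star y).
Proof.
move=> [n [m [a [e -> ->]]]]; exists m, n, (star a); split.
- by rewrite e addrK.
- exact: (tr_star hcan).
- exact: (tr_star hpi).
Qed.

(* On T(m,m) the kernel of dr_can consists of the a with |a (x) 1^s| -> 0. *)
Lemma hpair_nrm k x y : hpair k x y -> nrm y <= nrm x.
Proof.
move=> [n [m [a [_ -> ->]]]].
have h (c : T m m) : nrm (pi c) <= nrm (dr_can D c).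
  apply: (@ker_nrm R (end_alg T m) D B (@dr_can _ _ D m m) (@pi m m)).
  - exact: tens_rep_end_hom.
  - exact: tens_rep_end_hom.
  move=> b; rewrite (dr_canE D (k := 0)); last by rewrite addr0.
  move=> /dr_emb_inj1 b0; apply: nrm_eq0; apply/eqP.
  rewrite eq_le nrm_ge0 andbT.
  have := indlim_norm (dr_indlim g 0) (a := b) (esym (addr0 _)).
  rewrite b0 nrm0 => l0.
  apply: (@closed_cvg _ _ \oo _ (fun s => nrm (tensk s b)) (fun r : R => nrm (pi b) <= r) _ _ _ l0).
    exact: closed_ge.
  (* pi b = pi (b (x) 1^s) is bounded by |b (x) 1^s| for every s, hence by the limit 0. *)
  apply: nearW => s; rewrite -(tr_tensk hpi s).
  exact: (star_hom_nrm (tens_rep_end_hom (s + m) hpi)).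
(* The C*-identity replaces a by a^* a, which lies in T(m,m). *)
rewrite -(@ler_pXn2r _ 2) ?nnegrE ?nrm_ge0 // -!nrm_star_mul.
by rewrite (tr_star hcan) (tr_star hpi) (tr_mul hcan) (tr_mul hpi).
Qed.

(** The bound N on the degrees is kept because the first norm estimate depends on it; under products
    the bounds only add up. *)
Inductive gsum (N : nat) : D -> B -> Prop :=
| gsum0 : gsum N 0 0
| gsumH k x y x' y' : (`|k| <= N)%N -> hpair k x y -> gsum N x' y' ->
    gsum N (x + x') (y + y').

Lemma gsum_le N M x y : (N <= M)%N -> gsum N x y -> gsum M x y.
Proof.
move=> NM; elim=> [|k x' y' x'' y'' kN h _ ih]; first exact: gsum0.
by apply: (@gsumH _ k) => //; exact: leq_trans NM.
Qed.

Lemma gsumD N x y x' y' : gsum N x y -> gsum N x' y' -> gsum N (x + x') (y + y').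
Proof.
elim=> [|k u v x'' y'' kN h _ ih] h'; first by rewrite !add0r.
by rewrite -!addrA; apply: (gsumH kN h); exact: ih.
Qed.

Lemma hpair_gsum k x y : hpair k x y -> gsum `|k| x y.
Proof.
move=> h; rewrite -[x]addr0 -[y]addr0.
by apply: (gsumH (leqnn _) h); exact: gsum0.
Qed.

Lemma gsumZ N x y (c : R[i]) : gsum N x y -> gsum N (c *: x) (c *: y).
Proof.
elim=> [|k u v x'' y'' kN h _ ih]; first by rewrite !scaler0; exact: gsum0.
rewrite !scalerDr; apply: gsumH ih; first exact: kN.
by have := hpairD c h (hpair0 k); rewrite !addr0.
Qed.

Lemma gsum_star N x y : gsum N x y -> gsum N (cs_star x) (cs_star y).
Proof.
elim=> [|k u v x'' y'' kN h _ ih]; first by rewrite !cs_star0; exact: gsum0.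
rewrite !cs_starD; apply: gsumH ih; last exact: (hpair_star h).
by rewrite abszN.
Qed.

Lemma gsumM N M x y x' y' :
  gsum N x y -> gsum M x' y' -> gsum (N + M) (x ** x') (y ** y').
Proof.
elim=> [|k u v x'' y'' kN h _ ih] h'; first by rewrite !cs_mul0l; exact: gsum0.
rewrite !cs_mulDl; apply: gsumD (ih h').
elim: h' => [|j u' v' x3 y3 jM h' _ ih']; first by rewrite !cs_mul0r; exact: gsum0.
rewrite !cs_mulDr; apply: gsumH ih'; last exact: (hpairM h h').
by lia.
Qed.
End Extension.

(** * Circle averages and the norm bound on finite sums *)

Lemma unit_root_m1 (R : realType) (d : int) : d != 0 ->
  exists2 z : R[i], `|z| = 1 & z ^ d = -1.
Proof.
have pos n : exists2 z : R[i], `|z| = 1 & z ^+ n.+1 = -1.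
  have zn : (n.+1.-root (-1 : R[i])) ^+ n.+1 = -1 by exact: rootCK.
  exists (n.+1.-root (-1)) => //.
  apply/eqP; rewrite -(@eqrXn2 _ n.+1) ?normr_ge0 //.
  by rewrite -normrX zn normrN1 expr1n.
case: d => [[//|n] _|n _]; first exact: pos.
have [z z1 zn] := pos n; exists z => //.
by rewrite NegzE -exprnN zn invrN invr1.
Qed.

Section CircleAction.
Variables (R : realType) (T : rtcat R) (D : DR_model T).
Local Notation g := (dr_gr D).
Variables (r : seq int) (e : forall k, g k).
Hypotheses (ur : uniq r) (e0 : forall k, k \notin r -> e k = 0).

Let f k : D := dr_emb (e k).

Let dsumE (c : int -> R[i]) :
  dsum (@dr_emb _ _ D) (fun k => c k *: e k) = \sum_(k <- r) c k *: f k.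
Proof.
rewrite /dsum (@fsumT_seq _ _ r) //; last first.
  move=> k /e0 ->; rewrite scaler0; exact: (linear_0 (@dr_emb_linear _ _ D k)).
by apply: eq_bigr => k _; exact: (linear_Z (@dr_emb_linear _ _ D k)).
Qed.

Let circle (c : int -> R[i]) (z : R[i]) : `|z| = 1 ->
  nrm (\sum_(k <- r) (z ^ k * c k) *: f k) = nrm (\sum_(k <- r) c k *: f k).
Proof.
move=> z1; rewrite -!dsumE /nrm.
have fs : fin_supp (fun k => c k *: e k).
  apply: (@sub_finite_set _ _ [set` r]) => // k /=.
  by apply: contraNP => /negP /e0 ->; rewrite scaler0.
rewrite -(dr_circle z1 fs); congr (complex.Re `|dsum _ _|).
by apply: functional_extensionality_dep => k; rewrite scalerA.
Qed.

(* Averaging over 1 and z with z^(k - j) = -1 kills the degree k and fixes the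
   degree j. *)
Let average (j : int) (ks : seq int) : j \notin ks ->
  exists c : int -> R[i], [/\ c j = 1, forall k, k \in ks -> c k = 0 &
    nrm (\sum_(k <- r) c k *: f k) <= nrm (\sum_(k <- r) f k)].
Proof.
elim: ks => [_|k ks ih].
  by exists (fun=> 1); split=> //; under eq_bigr do rewrite scale1r.
rewrite inE negb_or => /andP[jk /ih[c [cj ck cf]]].
have [|z z1 zk] := @unit_root_m1 R (k - j); first by rewrite subr_eq0 eq_sym.
have z0 : z != 0 by rewrite -normr_eq0 z1 oner_eq0.
exists (fun i => (2^-1)%:C * (c i + z ^ (- j) * (z ^ i * c i))); split.
- rewrite cj mulr1 -expfzDr // addNr expr0z -mulr2n.
  by rewrite fmorphV rmorph_nat mulVf // pnatr_eq0.
- move=> i; rewrite inE => /orP[/eqP ->|/ck ->]; last by rewrite !mulr0 addr0 mulr0.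
  by rewrite mulrA -expfzDr // [- j + _]addrC zk mulN1r subrr mulr0.
under eq_bigr do rewrite -scalerA scalerDl -scalerA.
rewrite -scaler_sumr big_split -scaler_sumr nrmZR ?invr_ge0 //=.
have h : nrm (z ^ (- j) *: \sum_(i <- r) (z ^ i * c i) *: f i) <= nrm (\sum_(k <- r) f k).
  have zX i : `|z ^ i| = 1.
    by case: i => i; rewrite ?NegzE -?exprnN -?exprnP ?normfV normrX z1 expr1n ?invr1.
  by rewrite nrmZ1 ?circle.
rewrite mulrC ler_pdivrMr //; apply: le_trans (nrmD _ _) _.
by rewrite mulr_natr mulr2n lerD.
Qed.

(** No integral over the circle is taken: one two-point average for each degree other than j
    isolates the component. *)
Lemma component_nrm_le j : nrm (f j) <= nrm (\sum_(k <- r) f k).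
Proof.
have [jr|/e0] := boolP (j \in r); last first.
  by rewrite /f => ->; rewrite (linear_0 (@dr_emb_linear _ _ D j)) nrm0 nrm_ge0.
have [|c [cj ck]] := @average j (rem j r); first by rewrite mem_rem_uniqF.
rewrite (big_rem j) //= cj scale1r big_seq big1 ?addr0 //.
by move=> k /ck ->; rewrite scale0r.
Qed.
End CircleAction.

Section Norms.
Variables (R : realType) (T : rtcat R) (D : DR_model T) (B : cstarAlg R).
Variable pi : forall n m, T n m -> B.
Hypothesis hpi : is_tens_rep pi.
Local Notation gsum := (@gsum R T D B pi).
Local Notation hpair := (@hpair R T D B pi).

Let deg (N : nat) : seq int := [seq i%:Z - N%:Z | i <- iota 0 (2 * N).+1].

Let mem_deg N k : (k \in deg N) = (`|k| <= N)%N.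
Proof.
apply/mapP/idP => [[i + ->]|kN]; first by rewrite mem_iota; lia.
by exists `|(k + N%:Z)%R|%N; [rewrite mem_iota|]; lia.
Qed.

Let uniq_deg N : uniq (deg N).
Proof. by rewrite map_inj_uniq ?iota_uniq // => i j; lia. Qed.

(** Terms of equal degree are collected, so that at most 2 N + 1 homogeneous components remain,
    however many summands [gsum] has used. *)
Lemma gsum_components N x y : gsum N x y ->
  exists (f : int -> D) (h : int -> B), [/\ forall k, hpair k (f k) (h k),
    forall k, k \notin deg N -> f k = 0,
    x = \sum_(k <- deg N) f k & y = \sum_(k <- deg N) h k].
Proof.
elim=> [|k u v x' y' kN huv _ [f [h [fh f0 -> ->]]]].
  exists (fun=> 0), (fun=> 0); split=> //; rewrite ?big1 // => k.
  exact: hpair0.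
have add (V : nmodType) (F : int -> V) w :
    w + \sum_(j <- deg N) F j = \sum_(j <- deg N) (if j == k then w + F j else F j).
  rewrite (bigD1_seq k) ?mem_deg ?uniq_deg //= [RHS](bigD1_seq k) ?mem_deg ?uniq_deg //=.
  rewrite eqxx addrA; congr (_ + _).
  by apply: eq_bigr => j /negbTE ->.
exists (fun j => if j == k then u + f j else f j), (fun j => if j == k then v + h j else h j).
split; rewrite ?add // => j.
  case: eqP => [->|//].
  by have := hpairD hpi 1 huv (fh k); rewrite !scale1r.
case: eqP => [->|_ /f0 //]; by rewrite mem_deg kN.
Qed.

Lemma gsum_nrm_width N x y : gsum N x y -> nrm y <= (2 * N).+1%:R * nrm x.
Proof.
move=> /gsum_components[f [h [fh f0 -> ->]]].
have ex k : exists e : dr_gr D k, f k = dr_emb e.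
  have [n [m [a [e -> _]]]] := fh k; exists (dr_in (dr_gr D) k a).
  exact: dr_canE.
pose e k := projT1 (cid (ex k)).
have fe k : f k = dr_emb (e k) by rewrite /e; case: (cid _).
have e0 k : k \notin deg N -> e k = 0.
  by move=> /f0; rewrite fe => /dr_emb_inj1.
apply: le_trans (nrm_sum _ _ _) _.
have le k : nrm (h k) <= nrm (\sum_(k <- deg N) f k).
  apply: le_trans (hpair_nrm hpi (fh k)) _.
  under eq_bigr do rewrite fe; rewrite fe.
  exact: component_nrm_le.
apply: le_trans (ler_sum _ (fun k _ => le k)) _.
by rewrite big_const_seq count_predT size_map size_iota iter_addr addr0 mulr_natl.
Qed.

(** If b = (1 + d) a with d > 0, the powers of 1 + d would grow at most linearly in the exponent.
    Bernoulli's inequality alone gives only linear growth; its square gives quadratic growth, a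
    contradiction. *)
Lemma pow2_growth (a b : R) (M : nat) : 0 <= a -> 0 <= b ->
  (forall j, b ^+ (2 ^ j) <= (2 * (2 ^ j * M)).+1%:R * a ^+ (2 ^ j)) -> b <= a.
Proof.
move=> a0 b0 h; rewrite leNgt; apply/negP => ab.
have [a00|apos] := eqVneq a 0.
  by have := h 0%N; rewrite a00 !expr1 mulr0 leNgt -a00 ab.
have {}apos : 0 < a by rewrite lt_def apos.
pose d := b / a - 1.
have d0 : 0 < d by rewrite subr_gt0 ltr_pdivlMr // mul1r.
have hq j : (1 + d) ^+ (2 ^ j) <= (2 * (2 ^ j * M)).+1%:R.
  by rewrite /d addrC subrK expr_div_n ler_pdivrMr ?exprn_gt0.
have bern n : 1 + n%:R * d <= (1 + d) ^+ n.
  elim: n => [|n ih]; first by rewrite mul0r addr0.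
  rewrite exprS; have := ler_wpM2l (addr_ge0 ler01 (ltW d0)) ih.
  apply: le_trans; rewrite -natr1.
  have : 0 <= n%:R * d * d by rewrite !mulr_ge0 // ltW.
  by nra.
(* With K = 2^j and the hypothesis at j + 1: (K d)^2 <= (1 + d)^(2 K) <= 4 K M + 1 <= K (4 M +
   1). *)
have main j : (2 ^ j)%:R * d ^+ 2 <= (4 * M).+1%:R.
  have k0 : 0 < (2 ^ j)%:R :> R by rewrite ltr0n expn_gt0.
  have := hq j.+1; rewrite expnS mulnC exprM.
  have := bern (2 ^ j)%N.
  set K : R := (2 ^ j)%:R in k0 *; set E := (1 + d) ^+ _ => KE EE.
  have E0 : 0 <= E by rewrite exprn_ge0 // addr_ge0 // ltW.
  have KdE : (K * d) ^+ 2 <= E ^+ 2.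
    rewrite ler_pXn2r ?nnegrE ?mulr_ge0 ?(ltW k0) ?(ltW d0) //.
    by apply: le_trans KE; rewrite lerDr.
  have K1 : 1 <= K by rewrite /K ler1n expn_gt0.
  have EE' : E ^+ 2 <= K * (4 * M).+1%:R.
    apply: le_trans EE _; rewrite /K -natrM ler_nat; nia.
  by rewrite -(ler_pM2l k0); move: KdE EE'; rewrite exprMn; nra.
have [n hn] : exists n : nat, (4 * M).+1%:R / d ^+ 2 < n%:R.
  by exists (Num.truncn ((4 * M).+1%:R / d ^+ 2)).+1; exact: truncnS_gt.
have := main n; rewrite leNgt => /negP; apply.
rewrite -ltr_pdivrMr ?exprn_gt0 //; apply: lt_le_trans hn _.
by rewrite ler_nat ltnW // ltn_expl.
Qed.

Lemma gsum_nrm N x y : gsum N x y -> nrm y <= nrm x.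
Proof.
move=> xy.
(* Each passage from x to x^* x squares both norms exactly and doubles the bound on the degrees. *)
have pw j : exists x' y', [/\ gsum (2 ^ j * N) x' y', nrm x' = nrm x ^+ (2 ^ j)
    & nrm y' = nrm y ^+ (2 ^ j)].
  elim: j => [|j [x' [y' [gj ex ey]]]]; first by exists x, y; rewrite mul1n !expr1.
  exists (cs_star x' ** x'), (cs_star y' ** y'); split.
  - by rewrite expnS -mulnA mul2n -addnn; apply: gsumM => //; exact: gsum_star.
  - by rewrite nrm_star_mul ex -exprM mulnC -expnS.
  - by rewrite nrm_star_mul ey -exprM mulnC -expnS.
apply: (@pow2_growth _ _ N); rewrite ?nrm_ge0 // => j.
have [x' [y' [gj <- <-]]] := pw j; exact: gsum_nrm_width.
Qed.
End Norms.

(** * Extension to the completion *)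

Section ExtensionByContinuity.
Variables (R : realType) (T : rtcat R) (D : DR_model T) (B : cstarAlg R).
Variable pi : forall n m, T n m -> B.
Hypothesis hpi : is_tens_rep pi.
Local Notation gsum := (@gsum R T D B pi).
Local Notation hpair := (@hpair R T D B pi).

Definition alg_pair (x : D) (y : B) : Prop := exists N, gsum N x y.

Lemma alg_pairD x y x' y' (c : R[i]) :
  alg_pair x y -> alg_pair x' y' -> alg_pair (c *: x + x') (c *: y + y').
Proof.
move=> [N h] [N' h']; exists (maxn N N'); apply: gsumD.
  by apply: (gsum_le (leq_maxl N N')); apply: (gsumZ hpi).
exact: (gsum_le (leq_maxr N N')).
Qed.

Lemma alg_pairM x y x' y' :
  alg_pair x y -> alg_pair x' y' -> alg_pair (x ** x') (y ** y').
Proof. by move=> [N h] [N' h']; exists (N + N')%N; exact: gsumM. Qed.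

Lemma alg_pair_star x y : alg_pair x y -> alg_pair (cs_star x) (cs_star y).
Proof. by move=> [N h]; exists N; exact: gsum_star. Qed.

Lemma alg_pair_nrm x y : alg_pair x y -> nrm y <= nrm x.
Proof. by move=> [N h]; exact: (gsum_nrm hpi h). Qed.

Lemma alg_pair_can n m (a : T n m) : alg_pair (dr_can D a) (pi a).
Proof.
exists `|n%:Z - m%:Z|%N; apply: hpair_gsum; exists n, m, a; split=> //; lia.
Qed.

Let approx (x : D) := forall e : R, 0 < e ->
  exists x' y', alg_pair x' y' /\ nrm (x - x') < e.

Let approxD x y : approx x -> approx y -> approx (x + y).
Proof.
move=> ax ay e e0; have e2 : 0 < e / 2 by rewrite divr_gt0.
have [x1 [y1 [h1 d1]]] := ax _ e2; have [x2 [y2 [h2 d2]]] := ay _ e2.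
exists (x1 + x2), (y1 + y2); split.
  by have := alg_pairD 1 h1 h2; rewrite !scale1r.
rewrite opprD addrACA; apply: le_lt_trans (nrmD _ _) _; lra.
Qed.

Let approx_emb k (z : dr_gr D k) : approx (dr_emb z).
Proof.
move=> e e0.
have [_ [n [m [a [nm ->]]]] za] := dense_nrmP (indlim_dense (dr_indlim _ k)) z e0.
exists (dr_can D a), (pi a); split; first exact: alg_pair_can.
rewrite (dr_canE D a nm) -(linear_B (@dr_emb_linear _ _ D k)).
exact: le_lt_trans (dr_emb_nrm _) za.
Qed.

Lemma alg_pair_dense x (e : R) : 0 < e ->
  exists x' y', alg_pair x' y' /\ nrm (x - x') < e.
Proof.
move=> e0; have e2 : 0 < e / 2 by rewrite divr_gt0.
have [_ [z fz ->] xz] := dense_nrmP (@dr_dense _ _ D) x e2.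
have [x' [y' [h d]]] : exists x' y', alg_pair x' y' /\ nrm (dsum (@dr_emb _ _ D) z - x') < e / 2.
  have/finite_seqP[s sE] := fz.
  rewrite /dsum (@fsumT_seq _ _ (undup s)) ?undup_uniq //; last first.
    move=> k; rewrite mem_undup => /negP ks.
    have [->|zk] := eqVneq (z k) 0; first exact: (linear_0 (@dr_emb_linear _ _ D k)).
    by exfalso; apply: ks; have : [set k | z k != 0] k by []; rewrite sE.
  elim: (undup s) e e0 e2 {xz} => [|k r ih] e e0 e2.
    rewrite big_nil; exists 0, 0; split; first by exists 0%N; exact: gsum0.
    by rewrite subr0 nrm0.
  rewrite big_cons; apply: approxD e2; first exact: approx_emb.
  (* The induction hypothesis bounds the error by half of its argument. *)
  move=> d d0; have := ih (d * 2); rewrite mulfK //; apply=> //.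
  by rewrite mulr_gt0.
exists x', y'; split=> //.
by rewrite -(subrKA (dsum (@dr_emb _ _ D) z)); apply: le_lt_trans (nrmD _ _) _; lra.
Qed.

(** Closure of the graph [alg_pair]. The norm bound makes it single-valued and, as B is complete and
    the first projection dense, total. *)
Let rel (x : D) (y : B) := exists (u : nat -> D) (v : nat -> B),
  [/\ forall n, alg_pair (u n) (v n), u @ \oo --> x & v @ \oo --> y].

Let rel_nrm x y : rel x y -> nrm y <= nrm x.
Proof.
move=> [u [v [h ux vy]]].
have l1 : nrm (u n) @[n --> \oo] --> nrm x by exact: cvg_nrm.
have l2 : nrm (v n) @[n --> \oo] --> nrm y by exact: cvg_nrm.
by apply: (ler_cvg_to l2 l1); apply: nearW => n; exact: alg_pair_nrm.
Qed.

Let relD x y x' y' (c : R[i]) : rel x y -> rel x' y' -> rel (c *: x + x') (c *: y + y').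
Proof.
move=> [u [v [h ux vy]]] [u' [v' [h' ux' vy']]].
exists (fun n => c *: u n + u' n), (fun n => c *: v n + v' n); split.
- by move=> n; exact: alg_pairD.
- by apply: cvgD => //; apply: cvgZ => //; exact: cvg_cst.
- by apply: cvgD => //; apply: cvgZ => //; exact: cvg_cst.
Qed.

Let relM x y x' y' : rel x y -> rel x' y' -> rel (x ** x') (y ** y').
Proof.
move=> [u [v [h ux vy]]] [u' [v' [h' ux' vy']]].
exists (fun n => u n ** u' n), (fun n => v n ** v' n); split.
- by move=> n; exact: alg_pairM.
- exact: cvg_cs_mul.
- exact: cvg_cs_mul.
Qed.

Let rel_star x y : rel x y -> rel (cs_star x) (cs_star y).
Proof.
move=> [u [v [h ux vy]]].
exists (fun n => cs_star (u n)), (fun n => cs_star (v n)); split.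
- by move=> n; exact: alg_pair_star.
- exact: cvg_cs_star.
- exact: cvg_cs_star.
Qed.

Let rel_fun x y y' : rel x y -> rel x y' -> y = y'.
Proof.
move=> h h'; have := relD (-1) h h'; rewrite !scaleN1r !addNr => /rel_nrm.
rewrite nrm0 => le0; apply/eqP; rewrite eq_sym -subr_eq0 addrC; apply/eqP/nrm_eq0.
by apply/eqP; rewrite eq_le le0 nrm_ge0.
Qed.

Let rel_total x : exists y, rel x y.
Proof.
have ex n : exists p : D * B, alg_pair p.1 p.2 /\ nrm (x - p.1) < n.+1%:R^-1.
  have [|x' [y' [h d]]] := @alg_pair_dense x n.+1%:R^-1; first by rewrite invr_gt0.
  by exists (x', y').
have [w wP] := choice ex.
have inv_le n p : (n <= p)%N -> p.+1%:R^-1 <= n.+1%:R^-1 :> R.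
  by move=> np; rewrite lef_pV2 ?posrE // ler_nat.
have subE (V : lmodType R[i]) (a b : V) : -1 *: a + b = b - a.
  by rewrite scaleN1r addrC.
have [||y vy] := @nrm_cauchy_cvg R B (fun n => (w n).2) (fun n => 2 * n.+1%:R^-1).
- move=> n p np; have := alg_pair_nrm (alg_pairD (-1) (wP n).1 (wP p).1).
  rewrite !subE => h; apply: le_trans h _.
  have -> : (w p).1 - (w n).1 = (x - (w n).1) - (x - (w p).1).
    by lmod.
  apply: le_trans (nrmB _ _) _.
  have := (wP p).2; have := (wP n).2; have := inv_le n p np.
  move: (_^-1) (_^-1) => a b /=; lra.
- have -> : 0 = 2 * 0 :> R by rewrite mulr0.
  by apply: cvgM; [exact: cvg_cst|exact: cvg_harmonic].
exists y, (fun n => (w n).1), (fun n => (w n).2); split=> //.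
  by move=> n; exact: (wP n).1.
apply: (cvg_nrm0 (c := harmonic)); last exact: cvg_harmonic.
by move=> n; exact/ltW/(wP n).2.
Qed.

Lemma tens_rep_extends : exists2 Psi : D -> B, is_star_hom Psi &
  forall n m (a : T n m), Psi (dr_can D a) = pi a.
Proof.
have [Psi PsiP] := choice rel_total.
exists Psi; first split=> [c x y|x y|x].
- apply: (rel_fun (PsiP _)); exact: relD.
- apply: (rel_fun (PsiP _)); exact: relM.
- apply: (rel_fun (PsiP _)); exact: rel_star.
move=> n m a; apply: (rel_fun (PsiP _)).
exists (fun=> dr_can D a), (fun=> pi a); split; try exact: cvg_cst.
by move=> _; exact: alg_pair_can.
Qed.
End ExtensionByContinuity.

(** The density of [alg_pair] is applied to the family [dr_can] itself, with B = D. *)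
Lemma dr_generated (R : realType) (T : rtcat R) (D : DR_model T) (S : set D) :
  is_cstar_subalg S -> (forall n m (a : T n m), S (dr_can D a)) -> S = setT.
Proof.
move=> hS Sa; apply/seteqP; split=> // x _.
apply: (closed_nrmP (cstar_sub_closed hS)) => e e0.
have [x' [y' [[N h] d]]] := alg_pair_dense (dr_can_rep D) x e0.
exists x' => //; elim: h => [|k u v x1 y1 _ [n [m [a [_ -> _]]]] _ ih].
  exact: cstar_sub0.
rewrite -[dr_can _ _]scale1r; exact: (cstar_subD hS).
Qed.

(** Both composites fix the generators, and the points where two *-homomorphisms agree form a
    C*-subalgebra. *)
Lemma dr_iso (R : realType) (T : rtcat R) (D : DR_model T) (O : cstarAlg R)
    (pi : forall n m, T n m -> O) (Psi : O -> D) :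
  is_tens_rep pi -> is_star_hom Psi ->
  (forall n m (a : T n m), Psi (pi n m a) = dr_can D a) ->
  (forall S : set O, is_cstar_subalg S -> (forall n m a, S (pi n m a)) -> S = setT) ->
  exists Phi : D -> O, [/\ is_star_hom Phi, cancel Phi Psi, cancel Psi Phi &
    forall n m (a : T n m), Phi (dr_can D a) = pi n m a].
Proof.
move=> hpi hPsi PsiE gen.
have [Phi hPhi PhiE] := tens_rep_extends D hpi.
exists Phi; split=> //.
- move=> x; have := @dr_generated _ _ D _
    (star_hom_eq_closed (star_hom_comp hPhi hPsi) (star_hom_id D)).
  case/(_ _)/seteqP => [n m a|_ /(_ x I) //]; by rewrite /= PhiE PsiE.
- move=> x; have := gen _ (star_hom_eq_closed (star_hom_comp hPsi hPhi) (star_hom_id O)).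
  case/(_ _)/seteqP => [n m a|_ /(_ x I) //]; by rewrite /= PsiE PhiE.
Qed.

Lemma full_ideal (R : realType) (T : rtcat R) : is_ideal (@full R T).
Proof. by split=> // n m; exact: closedT. Qed.

Section FullRep.
Variables (R : realType) (T : rtcat R).

Lemma dr_iso_full (D : DR_model T) (O : O_model (full T) (full T)) :
  exists2 Phi : D -> O, is_star_iso Phi &
    forall n m (a : T n m), Phi (dr_can D a) = o_rep O a.
Proof.
have hO := rt_rep_tens_rep (o_rep_rt O) (@o_rep_coisometric _ _ _ _ O).
have [hD cD] := tens_rep_rt_rep (dr_can_rep D).
have [Psi hPsi PsiE] := o_universal O hD cD.
have [|S hS Sa|Phi [hPhi c1 c2 PhiE]] := @dr_iso _ _ D O (@o_rep _ _ _ _ O) Psi hO hPsi.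
- by move=> n m a; exact: PsiE.
- by apply: o_generated hS _ => n m a _; exact: Sa.
- by exists Phi => //; split=> //; exists Psi.
Qed.

(** No universal algebra has to be constructed: D with [dr_can] is itself a model of O_T(T,T). *)
Lemma dr_O_model (D : DR_model T) : exists (O : O_model (full T) (full T)) (Phi : D -> O),
  is_star_iso Phi.
Proof.
have [hD cD] := tens_rep_rt_rep (dr_can_rep D).
have gen (S : set D) : is_cstar_subalg S ->
    (forall n m (a : T n m), full T n m a -> S (dr_can D a)) -> S = setT.
  by move=> hS Sa; apply: dr_generated hS _ => n m a; exact: Sa.
have univ (B : cstarAlg R) (pi : forall n m, T n m -> B) :
    is_rt_rep (full T) pi -> coisometric (full T) pi ->
    exists2 Psi : D -> B, is_star_hom Psi &
      forall n m a, full T n m a -> Psi (dr_can D a) = pi n m a.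
  move=> h c; have [Psi hPsi PsiE] := tens_rep_extends D (rt_rep_tens_rep h c).
  by exists Psi.
exists (OModel hD cD gen univ), id; split; first exact: star_hom_id.
by exists id.
Qed.
End FullRep.

(** * The precategory K_J *)

Section Recast.
Variables (R : realType) (T : rtcat R).

Lemma recast_id n m (a : T n m) : recast n m a = a.
Proof. by rewrite /recast; case: eqP => // en; case: eqP => // em; rewrite !eq_axiomK. Qed.

Lemma recast_eq0 n m i j (a : T n m) : (n, m) != (i, j) -> recast i j a = 0.
Proof.
rewrite /recast; case: eqP => // en; case: eqP => // em; subst i j.
by rewrite eqxx.
Qed.

Lemma recast_lin n m i j (c : R[i]) (a b : T n m) :
  recast i j (c *: a + b) = c *: recast i j a + recast i j b.
Proof.
have [[<- <-]|nij] := eqVneq (n, m) (i, j); first by rewrite !recast_id.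
by rewrite !recast_eq0 // scaler0 addr0.
Qed.

Lemma recast0 n m i j : recast i j (0 : T n m) = 0.
Proof.
have [[<- <-]|nij] := eqVneq (n, m) (i, j); first by rewrite recast_id.
by rewrite recast_eq0.
Qed.

Lemma recast_star n m i j (a : T n m) : star (recast i j a) = recast j i (star a).
Proof.
have [[<- <-]|nij] := eqVneq (n, m) (i, j); first by rewrite !recast_id.
rewrite !recast_eq0 ?star0 //.
by apply: contra_neq nij => -[-> ->].
Qed.

Lemma tens1_0 n m : tens1 (0 : T n m) = 0.
Proof. exact: (linear_0 (@tens1_linear _ T n m)). Qed.

Lemma recast_tens1 n m i j (a : T n m) :
  recast i.+1 j.+1 (tens1 a) = tens1 (recast i j a).
Proof.
have [[<- <-]|nij] := eqVneq (n, m) (i, j); first by rewrite !recast_id.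
by rewrite !recast_eq0 ?tens1_0.
Qed.

Lemma tensk_lin k n m (c : R[i]) (a b : T n m) :
  tensk k (c *: a + b) = c *: tensk k a + tensk k b.
Proof. by elim: k => //= k ->; rewrite tens1_linear. Qed.

Lemma tensk0 k n m : tensk k (0 : T n m) = 0.
Proof. by elim: k => //= k ->; rewrite tens1_0. Qed.

Lemma ideal_recast (K : homsets T) n m i j (a : T n m) :
  is_ideal K -> K n m a -> K i j (recast i j a).
Proof.
move=> iK Ka; have [[<- <-]|nij] := eqVneq (n, m) (i, j); first by rewrite recast_id.
by rewrite recast_eq0 //; exact: ideal0.
Qed.

Lemma mat_ext (a b : mat T) : (forall i j, a i j = b i j) -> a = b.
Proof.
move=> ab; apply: functional_extensionality_dep => i.
by apply: functional_extensionality_dep => j.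
Qed.

Lemma iotaM_lin n m (c : R[i]) (a b : T n m) :
  iotaM (c *: a + b) = mat_lin c (iotaM a) (iotaM b).
Proof.
by apply: mat_ext => i j; exact: recast_lin.
Qed.

Lemma iotaM_star n m (a : T n m) : mat_star (iotaM a) = iotaM (star a).
Proof.
by apply: mat_ext => i j; exact: recast_star.
Qed.

(** Only the index (n, m, l, k) of the first sum survives; a term of the second one would need the
    row k + m of b to be less than m. *)
Lemma mat_mul_iota_le n m k l (a : T n m) (b : T (k + m)%N l) :
  mat_mul (iotaM a) (iotaM b) = iotaM (comp (tensk k a) b).
Proof.
apply: mat_ext => i i'.
rewrite /mat_mul (@fsumT_seq _ _ [:: (n, m, l, k)]) //; last first.
  move=> [[[n' m'] l'] k']; rewrite inE => ne.
  have [[en em]|nm] := eqVneq (n, m) (n', m'); last first.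
    by rewrite /iotaM (recast_eq0 a) // tensk0 comp0l recast0.
  subst n' m'; rewrite /iotaM (recast_eq0 b) ?comp0r ?recast0 //.
  by apply: contra_neq ne => -[/eqP]; rewrite eqn_add2r => /eqP -> ->.
rewrite big_seq1 fsbig1 ?addr0; last first.
  move=> [[[n' p'] l'] k'] _.
  have [[en em]|nm] := eqVneq (n, m) (n', (k'.+1 + p')%N); last first.
    by rewrite /iotaM (recast_eq0 a) // comp0l recast0.
  rewrite /iotaM (recast_eq0 b) ?tensk0 ?comp0r ?recast0 //.
  by apply/eqP => -[] ep; lia.
by rewrite /iotaM !recast_id.
Qed.

Lemma mat_mul_iota_gt n p k l (a : T n (k.+1 + p)%N) (b : T p l) :
  mat_mul (iotaM a) (iotaM b) = iotaM (comp a (tensk k.+1 b)).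
Proof.
apply: mat_ext => i i'.
rewrite /mat_mul addrC (@fsumT_seq _ _ [:: (n, p, l, k)]) //; last first.
  move=> [[[n' p'] l'] k']; rewrite inE => ne.
  have [[ep el]|pl] := eqVneq (p, l) (p', l'); last first.
    by rewrite /iotaM (recast_eq0 b) // tensk0 comp0r recast0.
  subst p' l'; rewrite /iotaM (recast_eq0 a) ?comp0l ?recast0 //.
  by apply: contra_neq ne => -[-> e]; rewrite (_ : k' = k) //; lia.
rewrite big_seq1 fsbig1 ?addr0; last first.
  move=> [[[n' m'] l'] k'] _.
  have [[en em]|nm] := eqVneq (n, (k.+1 + p)%N) (n', m'); last first.
    by rewrite /iotaM (recast_eq0 a) // tensk0 comp0l recast0.
  rewrite /iotaM (recast_eq0 b) ?comp0r ?recast0 //.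
  by apply/eqP => -[] ep; lia.
by rewrite /iotaM !recast_id.
Qed.

Lemma inM_iota (K : homsets T) n m i j (a : T i j) : is_ideal K ->
  K i j a -> i%:Z - j%:Z = n%:Z - m%:Z -> (j <= m)%N -> inM K n m (iotaM a).
Proof.
move=> iK Ka e jm; split=> [i' j'|i' j' nz]; first exact: ideal_recast.
have [[<- <-] //|nij] := eqVneq (i, j) (i', j').
by case: nz; exact: recast_eq0.
Qed.

Lemma inM_iota0 (K : homsets T) n m (a : T n m) : is_ideal K ->
  K n m a -> inM K n m (iotaM a).
Proof. by move=> iK Ka; exact: inM_iota. Qed.

Lemma inM_lin (K : homsets T) n m (c : R[i]) (a b : mat T) : is_ideal K ->
  inM K n m a -> inM K n m b -> inM K n m (mat_lin c a b).
Proof.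
move=> iK [Ka sa] [Kb sb]; split=> [i j|i j nz]; first exact: idealD.
have [a0|/eqP/sa //] := eqVneq (a i j) 0.
by apply: sb => b0; apply: nz; rewrite /mat_lin a0 b0 scaler0 addr0.
Qed.

Lemma xsum_lin (c : R[i]) (a b : mat T) p s :
  xsum (mat_lin c a b) p s = c *: xsum a p s + xsum b p s.
Proof.
rewrite /xsum scaler_sumr -big_split /=; apply: eq_bigr => i _.
by rewrite /mat_lin tensk_lin recast_lin.
Qed.

Lemma recast_tensk0 (a : mat T) k u p s : k = 0%N -> u = p ->
  recast p s (tensk k (a u s)) = a p s.
Proof. by move=> -> ->; rewrite recast_id. Qed.

Lemma recast_tenskS (a : mat T) k k' u u' v p s : k = k'.+1 -> u = u' ->
  recast p.+1 s.+1 (tensk k (a u v)) = tens1 (recast p s (tensk k' (a u' v))).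
Proof. by move=> -> ->; rewrite -recast_tens1. Qed.

(** Together with [xsum_base], the start of the recursion [xsumS]: a diagonal p - s = k begins at s
    = 0 if k >= 0 and at p = 0 if k <= 0. *)
Lemma xsum_base0 (a : mat T) p : xsum a p 0 = a p 0%N.
Proof.
rewrite /xsum big_mkcond big_nat1. by rewrite recast_tensk0 // addn0 subn0.
Qed.

Lemma xsum_base (a : mat T) s : xsum a 0 s = a 0%N s.
Proof.
rewrite /xsum big_mkcond big_nat_recr //= big_nat big1 ?add0r; last first.
  by move=> i /andP[_ si]; rewrite leqNgt add0n si.
by rewrite add0n leqnn recast_tensk0 ?subnn.
Qed.

(** The condition s <= p + i depends only on p - s, so moving along the diagonal adds one summand
    and tensors the others once more. *)
Lemma xsumS (a : mat T) p s :
  xsum a p.+1 s.+1 = tens1 (xsum a p s) + a p.+1 s.+1.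
Proof.
rewrite /xsum [LHS]big_mkcond big_nat_recr //= leq_addl recast_tensk0 ?addnK ?subnn //.
congr (_ + _); rewrite (linear_big (@tens1_linear _ T p s)) [RHS]big_mkcond /=.
rewrite !big_nat; apply: eq_bigr => i /andP[_ si].
rewrite addSn ltnS; case: ifP => // _; apply: recast_tenskS => //.
by rewrite subSn.
Qed.

Lemma xsum_iota_lt n m (a : T n m) p s : (s < m)%N -> xsum (iotaM a) p s = 0.
Proof.
move=> sm; rewrite /xsum big_nat_cond big1 // => i /andP[/andP[_ si] _].
rewrite /iotaM (recast_eq0 a) ?tensk0 ?recast0 //.
by apply/eqP => -[_ ?]; lia.
Qed.

Lemma xsum_iota n m (a : T n m) : xsum (iotaM a) n m = a.
Proof.
rewrite /xsum big_mkcond big_nat_recr //= leq_addl recast_tensk0 ?addnK ?subnn //.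
rewrite big_nat big1 ?add0r /= => [|i im]; first by rewrite /iotaM recast_id.
case: ifP => // _; rewrite /iotaM (recast_eq0 a) ?tensk0 ?recast0 //.
by apply/eqP => -[_ ?]; lia.
Qed.
End Recast.

Section QuotNrm.
Variables (R : realType) (T : rtcat R) (J : homsets T).
Arguments J : clear implicits.
Hypothesis iJ : is_ideal J.
Variables n m : nat.
Implicit Type x : T n m.

Let qset x := [set nrm (x - y) | y in J n m].

Let qset_lb x : lbound (qset x) 0.
Proof. by move=> _ [y _ <-]; exact: nrm_ge0. Qed.

Let qset_n0 x : qset x !=set0.
Proof. by exists (nrm (x - 0)), 0 => //; exact: ideal0. Qed.

Lemma quot_nrm_ge0 x : 0 <= quot_nrm J x.
Proof. by apply: lb_le_inf; [exact: qset_n0|exact: qset_lb]. Qed.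

Lemma quot_nrm_ideal x : J n m x -> quot_nrm J x = 0.
Proof.
move=> Jx; apply/eqP; rewrite eq_le quot_nrm_ge0 andbT.
apply: ge_inf; first by exists 0; exact: qset_lb.
by exists x => //; rewrite subrr nrm0.
Qed.

Lemma quot_nrm_eq0 x : quot_nrm J x = 0 -> J n m x.
Proof.
move=> x0; apply: closed_nrmP; first exact: ideal_closed.
move=> e e0; have [|_ [y Jy <-]] := @inf_adherent _ (qset x) e e0.
  by split; [exact: qset_n0|exists 0; exact: qset_lb].
by rewrite -/(quot_nrm J x) x0 add0r => xy; exists y.
Qed.
End QuotNrm.

Section Seminorm.
Variables (R : realType) (T : rtcat R) (J : homsets T).
Arguments J : clear implicits.
Hypothesis iJ : is_ideal J.

(** The equation p + m = n + s describes the diagonal without truncated subtraction, which suits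
    inductions on p and s. *)
Lemma mat_seminorm_eq0P n m (a : mat T) : mat_seminorm J n m a = 0 <->
  xsum a n m = 0 /\ forall p s, (s < m)%N -> (p + m = n + s)%N -> J p s (xsum a p s).
Proof.
rewrite /mat_seminorm; split.
  move=> h; have bge : 0 <= \big[Num.max/0]_(s < m | (m <= n + s)%N)
      quot_nrm J (xsum a (n + s - m)%N s).
    by apply: bigmax_ge_id.
  have h1 : nrm (xsum a n m) <= 0 by rewrite -h le_max lexx orbT.
  split; first by apply: nrm_eq0; apply/eqP; rewrite eq_le h1 nrm_ge0.
  move=> p s sm e; have ep : p = (n + s - m)%N by lia.
  apply: quot_nrm_eq0 => //; apply/eqP; rewrite eq_le quot_nrm_ge0 // andbT -h le_max.
  apply/orP; left; rewrite ep.
  by apply: (@le_bigmax_cond _ _ _ 0 (Ordinal sm) (fun s : 'I_m => (m <= n + s)%N)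
     (fun s : 'I_m => quot_nrm J (xsum a (n + s - m)%N s))) => /=; lia.
move=> [-> h]; rewrite nrm0; suff -> : \big[Num.max/0]_(s < m | (m <= n + s)%N)
    quot_nrm J (xsum a (n + s - m)%N s) = 0 by rewrite maxxx.
apply: (big_ind (fun r => r = 0)) => // [_ _ -> ->|s ms]; first by rewrite maxxx.
by apply: quot_nrm_ideal => //; apply: h => //; lia.
Qed.
End Seminorm.

(** * The family on K_J with values in O_T(K,J), and the isomorphism *)

Section KJ.
Variables (R : realType) (T : rtcat R) (K J : homsets T).
Arguments K : clear implicits.
Arguments J : clear implicits.
Hypotheses (iK : is_ideal K) (iJ : is_ideal J) (sub : subhom J (Jof K)).
Variables (S : KJ_model K J) (O : O_model K J).
Local Notation q := (kj_q S).
Let hO := o_rep_rt O.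

Lemma o_rep0 n m : o_rep O (0 : T n m) = 0.
Proof.
have := rep_linear hO 1 (ideal0 iK n m) (ideal0 iK n m).
by rewrite !scale1r addr0 => /eqP; rewrite -subr_eq0 opprD addrA subrr sub0r oppr_eq0 => /eqP.
Qed.

Lemma o_repD n m (a b : T n m) : K n m a -> K n m b ->
  o_rep O (a + b) = o_rep O a + o_rep O b.
Proof. by move=> Ka Kb; have := rep_linear hO 1 Ka Kb; rewrite !scale1r. Qed.

Lemma o_repZ n m c (a : T n m) : K n m a -> o_rep O (c *: a) = c *: o_rep O a.
Proof.
by move=> Ka; have := rep_linear hO c Ka (ideal0 iK n m); rewrite o_rep0 !addr0.
Qed.

(** Indexed like [xsum], with the tensoring dropped, so that both obey parallel recursions. *)
Definition mat_rep (a : mat T) (p s : nat) : O :=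
  \sum_(0 <= i < s.+1 | (s <= p + i)%N) o_rep O (a (p + i - s)%N i).

Lemma mat_rep_lin n m c (a b : mat T) p s : inM K n m a -> inM K n m b ->
  mat_rep (mat_lin c a b) p s = c *: mat_rep a p s + mat_rep b p s.
Proof.
move=> [Ka _] [Kb _]; rewrite /mat_rep scaler_sumr -big_split /=.
by apply: eq_bigr => i _; exact: (rep_linear hO).
Qed.

Lemma mat_rep_base0 (a : mat T) p : mat_rep a p 0 = o_rep O (a p 0%N).
Proof. by rewrite /mat_rep big_mkcond big_nat1 addn0 subn0. Qed.

Let o_rep_eq (a : mat T) u v s : u = v -> o_rep O (a u s) = o_rep O (a v s).
Proof. by move=> ->. Qed.

Lemma mat_rep_base (a : mat T) s : mat_rep a 0 s = o_rep O (a 0%N s).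
Proof.
rewrite /mat_rep big_mkcond big_nat_recr //= big_nat big1 ?add0r; last first.
  by move=> i /andP[_ si]; rewrite leqNgt add0n si.
by rewrite add0n leqnn; apply: o_rep_eq; rewrite subnn.
Qed.

Lemma mat_repS (a : mat T) p s :
  mat_rep a p.+1 s.+1 = mat_rep a p s + o_rep O (a p.+1 s.+1).
Proof.
rewrite /mat_rep [LHS]big_mkcond big_nat_recr //= leq_addl.
congr (_ + _); last by apply: o_rep_eq; rewrite addnK.
by rewrite [RHS]big_mkcond.
Qed.

Lemma mat_rep_iota n m i j (a : T i j) : i%:Z - j%:Z = n%:Z - m%:Z -> (j <= m)%N ->
  mat_rep (iotaM a) n m = o_rep O a.
Proof.
move=> e jm; rewrite /mat_rep big_mkcond (bigD1_seq j) ?iota_uniq //=; last first.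
  by rewrite mem_index_iota.
rewrite ifT; last by lia.
rewrite big1 => [|k kj].
  by rewrite addr0 (_ : n + j - m = i)%N ?/iotaM ?recast_id //; lia.
case: ifP => // _; rewrite /iotaM recast_eq0 ?o_rep0 //.
by apply: contra_neq kj => -[_ ->].
Qed.

(* x_s = x_(s-1) (x) 1 + a_(s+k,s), and the representation does not see the
   (x) 1 because x_(s-1) lies in J: the sum of the o_rep a_(i+k,i) telescopes. *)
Lemma o_rep_xsum n m (a : mat T) : inM K n m a ->
  (forall p s, (s < m)%N -> (p + m = n + s)%N -> J p s (xsum a p s)) ->
  forall s p, (s <= m)%N -> (p + m = n + s)%N ->
    K p s (xsum a p s) /\ o_rep O (xsum a p s) = mat_rep a p s.
Proof.
move=> [Ka _] h; elim=> [|s ih] [|p] sm e.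
- by rewrite xsum_base mat_rep_base.
- by rewrite xsum_base0 mat_rep_base0.
- by rewrite xsum_base mat_rep_base.
have e' : (p + m = n + s)%N by lia.
have [Kx xE] := ih p (ltnW sm) e'.
have Jx := h p s sm e'.
(* J in J(K) puts x_(s-1) (x) 1 back in K, where [o_rep] is additive. *)
have [_ Ktx] := sub Jx.
rewrite xsumS mat_repS; split; first exact: idealDD.
by rewrite o_repD // -(@o_rep_coisometric _ _ _ _ O _ _ _ Jx) xE.
Qed.

Lemma mat_rep_wd n m (a : mat T) : inM K n m a -> q n m a = 0 -> mat_rep a n m = 0.
Proof.
move=> ha q0; have /mat_seminorm_eq0P : mat_seminorm J n m a = 0.
  by rewrite -(kj_q_nrm S ha) q0 nrm0.
move=> /(_ iJ)[x0 h].
by have [_ <-] := o_rep_xsum ha h (leqnn m) (erefl _); rewrite x0 o_rep0.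
Qed.

Lemma kj_q_eq0 n m (a : mat T) : inM K n m a -> mat_seminorm J n m a = 0 -> q n m a = 0.
Proof. by move=> ha s0; apply: nrm_eq0; rewrite kj_q_nrm. Qed.

Lemma kj_q0 n m : q n m (fun _ _ => 0) = 0.
Proof.
apply: kj_q_eq0; first by split=> [i j|i j []//]; exact: ideal0.
have x0 p s : xsum (fun i j => 0 : T i j) p s = 0.
  by rewrite /xsum big1 // => i _; rewrite tensk0 recast0.
by apply/(mat_seminorm_eq0P iJ); split=> [//|p s _ _]; rewrite x0; exact: ideal0.
Qed.

(** The graph of the family, generated by single entries: its compatibility with products and
    adjoints is then checked on single-entry matrices, and only single-valuedness needs general
    ones. *)
Inductive kj_pair n m : S n m -> O -> Prop :=
| kj_pair0 : kj_pair 0 0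
| kj_pairI i j (a : T i j) y w : K i j a -> i%:Z - j%:Z = n%:Z - m%:Z ->
    (j <= m)%N -> kj_pair y w ->
    kj_pair (q n m (iotaM a) + y) (o_rep O a + w).

Lemma kj_pairD n m (y y' : S n m) w w' :
  kj_pair y w -> kj_pair y' w' -> kj_pair (y + y') (w + w').
Proof.
elim=> [|i j a u v Ka e jm _ ih] h; first by rewrite !add0r.
by rewrite -!addrA; apply: kj_pairI => //; exact: ih.
Qed.

Lemma kj_pair_iota n m i j (a : T i j) : K i j a -> i%:Z - j%:Z = n%:Z - m%:Z ->
  (j <= m)%N -> kj_pair (q n m (iotaM a)) (o_rep O a).
Proof.
move=> Ka e jm; rewrite -[q _ _ _]addr0 -[X in kj_pair _ X]addr0.
by apply: kj_pairI => //; exact: kj_pair0.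
Qed.

Let kj_q_iotaZ n m i j c (a : T i j) : K i j a -> i%:Z - j%:Z = n%:Z - m%:Z ->
  (j <= m)%N -> q n m (iotaM (c *: a)) = c *: q n m (iotaM a).
Proof.
move=> Ka e jm.
have z0 : iotaM (0 : T i j) = fun _ _ => 0 by apply: mat_ext => u v; exact: recast0.
rewrite -[c *: a]addr0 iotaM_lin kj_q_linear ?z0 ?kj_q0 ?addr0 //.
  exact: inM_iota.
by split=> [u v|u v []//]; exact: ideal0.
Qed.

Lemma kj_pairZ n m (y : S n m) w c : kj_pair y w -> kj_pair (c *: y) (c *: w).
Proof.
elim=> [|i j a u v Ka e jm _ ih]; first by rewrite !scaler0; exact: kj_pair0.
rewrite !scalerDr -kj_q_iotaZ // -o_repZ //; apply: kj_pairI => //.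
exact: idealZ.
Qed.

Lemma kj_pair_tens1 n m (y : S n m) w : kj_pair y w -> @kj_pair n.+1 m.+1 (tens1 y) w.
Proof.
elim=> [|i j a u v Ka e jm _ ih]; first by rewrite tens1_0; exact: kj_pair0.
rewrite (linear_D (@tens1_linear _ S n m)) -kj_q_tens1; last exact: inM_iota.
by apply: kj_pairI => //; lia.
Qed.

Lemma kj_pair_star n m (y : S n m) w : kj_pair y w -> kj_pair (star y) (cs_star w).
Proof.
elim=> [|i j a u v Ka e jm _ ih]; first by rewrite star0 cs_star0; exact: kj_pair0.
rewrite starD cs_starD -kj_q_star; last exact: inM_iota.
rewrite iotaM_star (rep_star hO Ka); apply: kj_pairI => //; try lia.
exact: ideal_star.
Qed.

(** The product rule of a representation tensors its left factor only. Tensoring the right factor is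
    the adjoint case, which is available because K is self-adjoint. *)
Lemma o_rep_mul_gt n p k l (a : T n (k.+1 + p)%N) (b : T p l) :
  K n (k.+1 + p)%N a -> K p l b ->
  o_rep O a ** o_rep O b = o_rep O (comp a (tensk k.+1 b)).
Proof.
move=> Ka Kb; rewrite -[LHS]cs_starK cs_star_mul (rep_star hO Ka) (rep_star hO Kb).
rewrite (rep_mul hO (ideal_star iK Kb) (ideal_star iK Ka)) tensk_star -star_comp.
rewrite (rep_star hO) ?starK //; apply: (ideal_star iK).
exact: (ideal_compr iK).
Qed.

Let kj_pairM1 n m l i j i' j' (a : T i j) (b : T i' j') :
  K i j a -> i%:Z - j%:Z = n%:Z - m%:Z -> (j <= m)%N ->
  K i' j' b -> i'%:Z - j'%:Z = m%:Z - l%:Z -> (j' <= l)%N ->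
  kj_pair (comp (q n m (iotaM a)) (q m l (iotaM b))) (o_rep O a ** o_rep O b).
Proof.
move=> Ka e jm Kb e' jl.
rewrite -kj_q_mul; [|exact: inM_iota|exact: inM_iota].
have [ji|ij] := leqP j i'.
  have ei : i' = ((i' - j) + j)%N by rewrite subnK.
  move: (i' - j)%N ei b Kb e' ji => k ei; subst i' => b Kb e' _.
  rewrite mat_mul_iota_le (rep_mul hO Ka Kb); apply: kj_pair_iota => //; last lia.
  exact: ideal_compl.
(* j > i', and the difference must appear as a successor to match the second sum of [mat_mul]. *)
have ej : j = ((j - i').-1.+1 + i')%N by lia.
move: ((j - i').-1) ej a Ka e jm ij => k ej; subst j => a Ka e jm _.
rewrite mat_mul_iota_gt o_rep_mul_gt //; apply: kj_pair_iota; try lia.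
exact: ideal_compr.
Qed.

Lemma kj_pairM n m l (y : S n m) w (z : S m l) v :
  kj_pair y w -> kj_pair z v -> kj_pair (comp y z) (w ** v).
Proof.
elim=> [|i j a u x Ka e jm _ ih] h; first by rewrite comp0l cs_mul0l; exact: kj_pair0.
rewrite compDl cs_mulDl; apply: kj_pairD (ih h).
elim: h => [|i' j' b u' x' Kb e' jl _ ih']; first by rewrite comp0r cs_mul0r; exact: kj_pair0.
rewrite compDr cs_mulDr; apply: kj_pairD ih'.
exact: kj_pairM1.
Qed.

Lemma kj_pair_mat n m (y : S n m) w : kj_pair y w ->
  exists a, [/\ inM K n m a, q n m a = y & mat_rep a n m = w].
Proof.
elim=> [|i j b u v Kb e jm _ [a [ha qa wa]]].
  exists (fun _ _ => 0); split; rewrite ?kj_q0 //.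
    by split=> [i j|i j []//]; exact: ideal0.
  by rewrite /mat_rep big1 // => i _; rewrite o_rep0.
have hb : inM K n m (iotaM b) by exact: inM_iota.
exists (mat_lin 1 (iotaM b) a); split; first exact: inM_lin.
  by rewrite kj_q_linear // scale1r qa.
by rewrite (mat_rep_lin _ _ _ hb ha) scale1r wa mat_rep_iota.
Qed.

(** By linearity w - w' is paired with the class 0; it is the [mat_rep] of a matrix of seminorm 0,
    which vanishes by [mat_rep_wd]. *)
Lemma kj_pair_fun n m (y : S n m) w w' : kj_pair y w -> kj_pair y w' -> w = w'.
Proof.
move=> h h'; have := kj_pairD h (kj_pairZ (-1) h').
rewrite !scaleN1r subrr => /kj_pair_mat[a [ha qa wa]].
by apply/eqP; rewrite -subr_eq0 -wa mat_rep_wd.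
Qed.

Lemma kj_pair_total n m (y : S n m) : exists w, kj_pair y w.
Proof.
have [a ha <-] := kj_q_surj y; have [Ka sa] := ha.
(* The fixed degree leaves at most one nonzero entry per column, so raising s by one adds at most
   one single-entry matrix. *)
pose cut s : mat T := fun i j => if (j < s)%N then a i j else 0.
have hcut s : inM K n m (cut s).
  split=> i j; rewrite /cut; case: ifP => // _; first exact: ideal0.
  exact: sa.
suff h s : exists w, kj_pair (q n m (cut s)) w.
  have [w hw] := h m.+1; exists w.
  rewrite (_ : a = cut m.+1) //; apply: mat_ext => i j; rewrite /cut.
  case: ifP => // jm; have [//|/eqP/sa[_]] := eqVneq (a i j) 0.
  by rewrite -ltnS jm.
elim: s => [|s [w hw]].
  by exists 0; rewrite (_ : cut 0%N = fun _ _ => 0) ?kj_q0; [exact: kj_pair0|exact: mat_ext].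
(* Otherwise column s is zero: its only possible entry sits in row n + s - m, which must be a
   natural number, and s must not exceed m. *)
have [/andP[nms sm]|bad] := boolP ((m <= n + s) && (s <= m))%N; last first.
  exists w; rewrite (_ : cut s.+1 = cut s) //; apply: mat_ext => i j.
  rewrite /cut ltnS leq_eqVlt; case: eqVneq => [->|//]; rewrite ltnn.
  have [->//|/eqP/sa[e sm]] := eqVneq (a i s) 0.
  by exfalso; move/negP: bad; apply; lia.
have hi : inM K n m (iotaM (a (n + s - m)%N s)) by apply: inM_iota => //; lia.
exists (o_rep O (a (n + s - m)%N s) + w).
rewrite (_ : cut s.+1 = mat_lin 1 (iotaM (a (n + s - m)%N s)) (cut s)).
  rewrite kj_q_linear // scale1r; apply: kj_pairI => //; lia.
apply: mat_ext => i j; rewrite /cut /mat_lin scale1r /iotaM ltnS leq_eqVlt.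
have [->|js] := eqVneq j s; rewrite /= ?ltnn ?addr0.
  have [->|ne] := eqVneq i (n + s - m)%N; first by rewrite recast_id.
  rewrite recast_eq0; last by apply: contra_neq ne => -[->].
  have [//|/eqP/sa[e _]] := eqVneq (a i s) 0.
  by case/negP: ne; lia.
by rewrite recast_eq0 ?add0r //; apply: contra_neq js => -[_ ->].
Qed.

Lemma kj_tens_rep : exists2 pi : (forall n m, S n m -> O), is_tens_rep pi &
  forall n m (y : S n m), kj_pair y (pi n m y).
Proof.
pose pi n m (y : S n m) := projT1 (cid (kj_pair_total y)).
have piP n m (y : S n m) : kj_pair y (pi n m y) by rewrite /pi; case: cid.
exists pi => //.
split=> [n m c y z|n m y|n m l y z|n m y].
- by apply: (kj_pair_fun (piP _ _ _)); apply: kj_pairD; [exact: kj_pairZ|].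
- by apply/esym; apply: (kj_pair_fun (piP _ _ _)); exact: kj_pair_star.
- by apply/esym; apply: (kj_pair_fun (piP _ _ _)); exact: kj_pairM.
- by apply: (kj_pair_fun (piP _ _ _)); exact: kj_pair_tens1.
Qed.

Variable D : DR_model S.

Definition kj_can n m (a : T n m) : D := dr_can D (q n m (iotaM a)).

Let hD := dr_can_rep D.

(** Tensoring in K_J is induced by an inclusion, so it keeps the entry a at its place (n,m) instead
    of moving it to a (x) 1^d. *)
Lemma kj_q_tensk d n m (a : T n m) : K n m a ->
  q (d + n)%N (d + m)%N (iotaM a) = tensk d (q n m (iotaM a)).
Proof.
move=> Ka; elim: d => // d ih.
rewrite -[tensk d.+1 _]/(tens1 (tensk d _)) -ih; apply: (@kj_q_tens1 _ _ _ _ S (d + n)%N (d + m)%N).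
by apply: inM_iota => //; [lia|exact: leq_addl].
Qed.

Lemma dr_can_kj_q n m i j (a : T i j) : K i j a -> i%:Z - j%:Z = n%:Z - m%:Z ->
  (j <= m)%N -> dr_can D (q n m (iotaM a)) = kj_can a.
Proof.
move=> Ka e jm; have em : m = ((m - j) + j)%N by rewrite subnK.
have en : n = ((m - j) + i)%N by lia.
by rewrite em en kj_q_tensk // (tr_tensk hD).
Qed.

Lemma kj_can_rt_rep : is_rt_rep K kj_can.
Proof.
split=> [n m c a b Ka Kb|n m a Ka|n m k l a b Ka Kb].
- rewrite /kj_can iotaM_lin kj_q_linear; [|exact: inM_iota0|exact: inM_iota0].
  exact: (tr_linear hD).
- by rewrite /kj_can (tr_star hD) -iotaM_star kj_q_star //; exact: inM_iota0.
- rewrite /kj_can.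
  rewrite -(tr_tensk hD k) (tr_mul hD) -kj_q_tensk // -kj_q_mul.
  + by rewrite mat_mul_iota_le.
  + by apply: inM_iota => //; [lia|exact: leq_addl].
  + exact: inM_iota0.
Qed.

(** In M(n+1,m+1), the matrix with entries a at (n,m) and - a (x) 1 at (n+1,m+1) has x_(m+1) = 0,
    x_m = a in J and all lower sums 0. Its seminorm is 0. *)
Lemma kj_can_coisometric : coisometric J kj_can.
Proof.
move=> n m a Ja; have [Ka Kta] := sub Ja.
rewrite -(@dr_can_kj_q n.+1 m.+1) //; last lia.
rewrite /kj_can; congr (dr_can D _).
apply/eqP; rewrite -subr_eq0 -scaleN1r addrC; apply/eqP.
have h1 : inM K n.+1 m.+1 (iotaM a) by apply: inM_iota => //; lia.
have h2 : inM K n.+1 m.+1 (iotaM (tens1 a)) by exact: inM_iota0.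
rewrite -kj_q_linear //; apply: kj_q_eq0; first exact: inM_lin.
apply/(mat_seminorm_eq0P iJ); split.
  rewrite xsum_lin xsum_iota xsumS xsum_iota /iotaM (recast_eq0 a).
    by rewrite addr0 scaleN1r addNr.
  by apply/eqP => -[]; lia.
move=> p s; rewrite ltnS leq_eqVlt => /orP[/eqP -> e|sm e].
  have -> : p = n by lia.
  by rewrite xsum_lin xsum_iota (xsum_iota_lt (tens1 a)) // scaler0 add0r.
by rewrite xsum_lin !xsum_iota_lt ?ltnS ?(ltnW sm) // scaler0 addr0; exact: ideal0.
Qed.

Lemma O_iso_dr_kj : exists2 Phi : O -> D, is_star_iso Phi &
  forall n m (a : T n m), K n m a -> Phi (o_rep O a) = kj_can a.
Proof.
have [Psi hPsi PsiE] := o_universal O kj_can_rt_rep kj_can_coisometric.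
have [pi hpi piP] := kj_tens_rep.
(* Psi is known on the generators [o_rep a] only; induction on the graph transfers this to the
   family pi. *)
have pair n m (y : S n m) w : kj_pair y w -> Psi w = dr_can D y.
  elim=> [|i j a u v Ka e jm _ ih].
    by rewrite (star_hom0 hPsi) (linear_0 (@tr_linear _ _ _ _ hD n m)).
  rewrite (star_homD hPsi) (linear_D (@tr_linear _ _ _ _ hD n m)) ih.
  by rewrite (dr_can_kj_q Ka) // PsiE.
(* Each [o_rep a] with a in K is pi of the class of the single-entry matrix, so the image of pi
   generates O. *)
have gen (X : set O) : is_cstar_subalg X -> (forall n m a, X (pi n m a)) -> X = setT.
  move=> hX Xa; apply: (o_generated hX) => n m a Ka.
  by rewrite (kj_pair_fun (kj_pair_iota Ka (erefl _) (leqnn m)) (piP _ _ _)).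
have [|Phi [_ c1 c2 _]] := @dr_iso _ _ D O pi Psi hpi hPsi _ gen.
  by move=> n m y; exact: pair.
by exists Psi => //; split=> //; exists Phi.
Qed.
End KJ.

Theorem proposition5p1 (R : realType) (T : rtcat R) :
  [/\ forall (D : DR_model T) (O : O_model (full T) (full T)),
        exists2 Phi : D -> O, is_star_iso Phi &
          forall n m (a : T n m), Phi (dr_can D a) = o_rep O a,
      forall D : DR_model T,
        exists K J : homsets T,
          [/\ is_ideal K, is_ideal J, subhom J (Jof K) &
            exists (O : O_model K J) (Phi : D -> O), is_star_iso Phi]
    & forall K J : homsets T, is_ideal K -> is_ideal J -> subhom J (Jof K) ->
        forall (S : KJ_model K J) (O : O_model K J) (D : DR_model S),
          exists2 Phi : O -> D, is_star_iso Phi &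
            forall n m (a : T n m), K n m a ->
              Phi (o_rep O a) = dr_can D (kj_q S n m (iotaM a))].
Proof.
split.
- exact: dr_iso_full.
- move=> D; exists (@full R T), (@full R T).
  have [M [Phi hPhi]] := dr_O_model D.
  by split; [exact: full_ideal|exact: full_ideal|split|exists M, Phi].
- move=> K J iK iJ sub S O D; exact: O_iso_dr_kj.
Qed.
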